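(* Consider the extremum seeking system with feedback law $u_{i,1}(J(x),\tau)=\sqrt{2\omega_i}\cos(J(x)+\omega_i\tau)$, $u_{i,2}(J(x),\tau)=\sqrt{2\omega_i}\sin(J(x)+\omega_i\tau)$, written in shifted coordinates $\tilde x=x-x^\star$: $$\dot{\tilde x}=b_0(\tilde x+x^\star)+\varepsilon^{-1}\sum_{i=1}^r\sum_{j=1}^2b_{i,j}u_{i,j}(J(\tilde x+x^\star),\tau),\qquad\dot\tau=\varepsilon^{-2}.$$ Suppose the Excitation Assumption holds with constant $\gamma$ and the Regularity Assumption holds with constant $\kappa_3$, with $\gamma>\kappa_3$, and suppose $J$ is a radially unbounded $\mathcal{C}^2$ function for which there exist $\alpha_J\in\mathcal{K}$ and $M_J>0$ with $\alpha_J(|x-x^\star|)^2\le|\nabla J(x)|^2\le M_J^2$ for all $x\in\mathbb{R}^n$. Then the origin $\tilde x=0$ is uniformly globally practically asymptotically stable for this system.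
   Context: $|\cdot|$ is the Euclidean norm; $\mathcal{K},\mathcal{KL}$ standard comparison-function classes. Data: $n\ge1$, $r$ a positive integer with $r\ge n/2$, vectors $b_{i,j}\in\mathbb{R}^n$ ($i=1,\dots,r$, $j=1,2$), distinct positive rationals $\omega_1,\dots,\omega_r$, a map $b_0:\mathbb{R}^n\to\mathbb{R}^n$, a cost $J:\mathbb{R}^n\to\mathbb{R}$ with $J^\star:=\inf_xJ(x)>-\infty$ attained at a unique $x^\star$, and a parameter $\varepsilon>0$. Excitation Assumption: there is $\gamma>0$ with $\sum_{i=1}^r\sum_{j=1}^2(b_{i,j}^\top v)^2\ge\gamma|v|^2$ for all $v\in\mathbb{R}^n$. Regularity Assumption: (a) $J(x)>J(x^\star)$ for $x\ne x^\star$; (b) $\nabla J(x)=0$ iff $x=x^\star$; (c) there is $L_J>0$ with $|\nabla^2J(x)|\le L_J$ for all $x$; (d) there is $\kappa_3>0$ with $|b_0(x)|\le\kappa_3|\nabla J(x)|$ for all $x$; (e) there is $L_0>0$ with $|b_0(x_1)-b_0(x_2)|\le L_0|x_1-x_2|$ for all $x_1,x_2$. Solutions: for initial $(\tilde x_0,\tau_0)\in\mathbb{R}^n\times\mathbb{R}_{\ge0}$, a $\mathcal{C}^1$ function on $[0,t_s)$, $t_s\in(0,\infty]$, satisfying the ODE and initial condition. The origin is uniformly globally practically asymptotically stable if there is $\beta\in\mathcal{KL}$ such that for every $\nu>0$ there is $\varepsilon^*>0$ such that for all $\varepsilon\in(0,\varepsilon^* )$ every solution from every initial condition is defined for all $t\ge0$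 and satisfies $|\tilde x(t)|\le\beta(|\tilde x_0|,t)+\nu$ for all $t\ge0$. *)

(* Defs.v *)
From HB Require Import structures.
From mathcomp Require Import all_boot all_order all_algebra.
From mathcomp Require Import all_classical all_reals all_analysis.
Set Implicit Arguments. Unset Strict Implicit. Unset Printing Implicit Defensive.
Import Order.TTheory GRing.Theory Num.Theory.
Import numFieldNormedType.Exports.
Local Open Scope classical_set_scope.
Local Open Scope ring_scope.

Section Defs.
Variable R : realType.

Definition edot (n : nat) (u v : 'rV[R]_n) : R := \sum_(k < n) u 0 k * v 0 k.
Definition enorm (n : nat) (v : 'rV[R]_n) : R := Num.sqrt (edot v v).

Definition ebasis (n : nat) (i : 'I_n) : 'rV[R]_n := delta_mx 0 i.

Definition partial (n : nat) (f : 'rV[R]_n -> R) (i : 'I_n) (x : 'rV[R]_n) : R :=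
  'D_(ebasis i) f x.
Definition grad (n : nat) (f : 'rV[R]_n -> R) (x : 'rV[R]_n) : 'rV[R]_n :=
  \row_i partial f i x.
Definition hess (n : nat) (f : 'rV[R]_n -> R) (x : 'rV[R]_n) : 'M[R]_n :=
  \matrix_(i, j) partial (fun y => partial f i y) j x.

Definition C2 (n : nat) (f : 'rV[R]_n -> R) : Prop :=
  (forall x, differentiable f x) /\
  (forall i x, differentiable (partial f i) x) /\
  continuous (hess f).

(* Operator (spectral) norm of a square matrix bounded by c:
   |A v| <= c |v| for all v (A acting on column vectors, written v *m A^T). *)
Definition opnorm_le (n : nat) (A : 'M[R]_n) (c : R) : Prop :=
  forall v : 'rV[R]_n, enorm (v *m A^T) <= c * enorm v.

Definition class_K (a : R -> R) : Prop :=
  a 0 = 0 /\ {within [set s | 0 <= s], continuous a} /\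
  (forall s1 s2, 0 <= s1 -> s1 < s2 -> a s1 < a s2).
Definition class_KL (b : R -> R -> R) : Prop :=
  (forall t, 0 <= t -> class_K (fun s => b s t)) /\
  (forall s, 0 <= s ->
     (forall t1 t2, 0 <= t1 -> t1 <= t2 -> b s t2 <= b s t1) /\
     (b s t @[t --> +oo] --> 0)).

Definition es_field (n r : nat) (b0 : 'rV[R]_n -> 'rV[R]_n) (J : 'rV[R]_n -> R)
  (b : 'I_r -> 'I_2 -> 'rV[R]_n) (omega : 'I_r -> rat) (xstar : 'rV[R]_n)
  (eps : R) (xt : 'rV[R]_n) (tau : R) : 'rV[R]_n :=
  b0 (xt + xstar) +
  eps^-1 *: \sum_(i < r)
     (Num.sqrt (2 * ratr (omega i)) *
        cos (J (xt + xstar) + ratr (omega i) * tau) *: b i 0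
      + Num.sqrt (2 * ratr (omega i)) *
        sin (J (xt + xstar) + ratr (omega i) * tau) *: b i 1).

(* (xs, taus) is a solution on [0, ts) (ts in (0, +oo]) from (x0, tau0):
   continuous on [0, ts), differentiable on (0, ts) satisfying the ODE
   xt' = es_field eps xt tau, tau' = eps^-2, and with the initial condition.
   (Since the right-hand side is continuous, this is the same as being C^1
   on [0, ts) with one-sided derivative at 0.) *)
Definition es_solution (n r : nat) (b0 : 'rV[R]_n -> 'rV[R]_n) (J : 'rV[R]_n -> R)
  (b : 'I_r -> 'I_2 -> 'rV[R]_n) (omega : 'I_r -> rat) (xstar : 'rV[R]_n)
  (eps : R) (x0 : 'rV[R]_n) (tau0 : R) (ts : \bar R)
  (xs : R -> 'rV[R]_n) (taus : R -> R) : Prop :=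
  (0 < ts)%E /\
  xs 0 = x0 /\ taus 0 = tau0 /\
  {within [set t | 0 <= t /\ (t%:E < ts)%E], continuous xs} /\
  {within [set t | 0 <= t /\ (t%:E < ts)%E], continuous taus} /\
  (forall t, 0 < t -> (t%:E < ts)%E ->
     is_derive t 1 xs (es_field b0 J b omega xstar eps (xs t) (taus t)) /\
     is_derive t 1 taus (eps ^- 2)).

End Defs.

(* Main.v *)
(* A near-identity change of coordinates removes the oscillation.  Let
   [U_m = cos, sin (J(x) + omega_m tau)], let [V_m] be the primitive of [U_m]
   in its argument and [a_m = sqrt (2 omega_m)].  Then
     z = x - eps sum_m (a_m / omega_m) V_m b_m
           + eps^2 sum_{m, m'} (a_m a_m' / omega_m) A_{m m'} (grad J(x) . b_m') b_m,
   with [A_{m m'}] a bounded primitive in [tau] of [U_m U_m'] minus its mean, is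
   [O(eps)]-close to [x] and obeys [z' = b0(x) - sum_m b_m b_m^T grad J(x) + O(eps)],
   with constants independent of [eps <= 1] and of the initial condition.  Such
   [A_{m m'}] exist because the frequencies are distinct, and only one derivative
   of [grad J] is needed.  Hence [y = J(z) - J(xstar)] satisfies
   [y' <= - (gamma - kappa3) |grad J(z)|^2 + O(eps)], that is [y' <= - rho(y)] above
   a small level, and so [y(t) + t rho(y(t)) <= y(0)] there.  Together with a class K
   minorant [mu] of [J - J(xstar)] this bounds [r = |z - xstar|] by the solution of
   [mu(r) + t rho(mu(r)) = 2 MJ s], a class KL function of [(s, t)]. *)
Require Import Defs.
From HB Require Import structures.
From mathcomp Require Import all_boot all_order all_algebra.
From mathcomp Require Import all_classical all_reals all_analysis.
From mathcomp Require Import ring lra.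
Set Implicit Arguments.
Unset Strict Implicit.
Unset Printing Implicit Defensive.
Import Order.TTheory GRing.Theory Num.Theory.
Import numFieldNormedType.Exports.
Local Open Scope classical_set_scope.
Local Open Scope ring_scope.

(** * Euclidean norm *)

Section EuclideanNorm.
Context {R : realType} {n : nat}.
Implicit Types (u v w : 'rV[R]_n) (a : R).

Lemma edotC u v : edot u v = edot v u.
Proof. by apply: eq_bigr => k _; rewrite mulrC. Qed.

Lemma edotDl u v w : edot (u + v) w = edot u w + edot v w.
Proof. by rewrite -big_split; apply: eq_bigr => k _; rewrite /= mxE mulrDl. Qed.

Lemma edotDr u v w : edot w (u + v) = edot w u + edot w v.
Proof. by rewrite edotC edotDl !(edotC w). Qed.

Lemma edotZl a u v : edot (a *: u) v = a * edot u v.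
Proof. by rewrite mulr_sumr; apply: eq_bigr => k _; rewrite mxE mulrA. Qed.

Lemma edotZr a u v : edot u (a *: v) = a * edot u v.
Proof. by rewrite edotC edotZl edotC. Qed.

Lemma edotNl u v : edot (- u) v = - edot u v.
Proof. by rewrite -scaleN1r edotZl mulN1r. Qed.

Lemma edotNr u v : edot u (- v) = - edot u v.
Proof. by rewrite edotC edotNl edotC. Qed.

Lemma edotBl u v w : edot (u - v) w = edot u w - edot v w.
Proof. by rewrite edotDl edotNl. Qed.

Lemma edotBr u v w : edot w (u - v) = edot w u - edot w v.
Proof. by rewrite edotDr edotNr. Qed.

Lemma edot0l v : edot 0 v = 0.
Proof. by rewrite -(scale0r v) edotZl mul0r. Qed.

Lemma edot_sumr (I : finType) (F : I -> 'rV[R]_n) u :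
  edot u (\sum_i F i) = \sum_i edot u (F i).
Proof.
elim/big_rec2: _ => [|i y z _ <-]; first by rewrite edotC edot0l.
by rewrite edotDr.
Qed.

Lemma edot_ge0 v : 0 <= edot v v.
Proof. by apply: sumr_ge0 => k _; rewrite -expr2 sqr_ge0. Qed.

Lemma enorm_ge0 v : 0 <= enorm v.
Proof. exact: sqrtr_ge0. Qed.

Lemma sqr_enorm v : enorm v ^+ 2 = edot v v.
Proof. by rewrite sqr_sqrtr // edot_ge0. Qed.

Lemma enorm0 : enorm (0 : 'rV[R]_n) = 0.
Proof. by rewrite /enorm edot0l sqrtr0. Qed.

Lemma enorm_eq0 v : enorm v = 0 -> v = 0.
Proof.
move=> v0; have : edot v v = 0 by rewrite -sqr_enorm v0 expr0n.
move=> /eqP; rewrite psumr_eq0 => [/allP v2|k _]; last by rewrite -expr2 sqr_ge0.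
apply/rowP => k; rewrite mxE; apply/eqP.
by have := v2 k (mem_index_enum _); rewrite /= mulf_eq0 orbb.
Qed.

Lemma enormZ a v : enorm (a *: v) = `|a| * enorm v.
Proof.
by rewrite /enorm edotZl edotZr mulrA -expr2 sqrtrM ?sqr_ge0// sqrtr_sqr.
Qed.

Lemma enormN v : enorm (- v) = enorm v.
Proof. by rewrite -scaleN1r enormZ normrN1 mul1r. Qed.

Lemma enormB u v : enorm (u - v) = enorm (v - u).
Proof. by rewrite -enormN opprB. Qed.

(** Cauchy-Schwarz: once zero norms are set aside, the square of [enorm v *: u - enorm u *: v] is
    nonnegative, and its expansion is the claim multiplied by [2 * (enorm u * enorm v)]. *)
Lemma edot_le_enorm u v : edot u v <= enorm u * enorm v.
Proof.
have [v0|v_neq0] := eqVneq (enorm v) 0.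
  by rewrite (enorm_eq0 v0) enorm0 mulr0 edotC edot0l.
have [u0|u_neq0] := eqVneq (enorm u) 0.
  by rewrite (enorm_eq0 u0) enorm0 mul0r edot0l.
have u_gt0 : 0 < enorm u by rewrite lt_def u_neq0 enorm_ge0.
have v_gt0 : 0 < enorm v by rewrite lt_def v_neq0 enorm_ge0.
have := edot_ge0 (enorm v *: u - enorm u *: v).
rewrite !(edotBl, edotBr, edotZl, edotZr) (edotC v u) -!sqr_enorm => le_uv.
rewrite -subr_ge0 -(@pmulr_rge0 _ (2 * (enorm u * enorm v))) ?mulr_gt0//.
lra.
Qed.

Lemma edot_norm_le u v : `|edot u v| <= enorm u * enorm v.
Proof.
by rewrite ler_norml edot_le_enorm andbT lerNl -edotNl -(enormN u) edot_le_enorm.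
Qed.

Lemma enormD_le u v : enorm (u + v) <= enorm u + enorm v.
Proof.
rewrite -(@ler_pXn2r _ 2) ?nnegrE ?addr_ge0 ?enorm_ge0//.
rewrite sqr_enorm !(edotDl, edotDr) (edotC v u) -!sqr_enorm.
have := edot_le_enorm u v; lra.
Qed.

Lemma enorm_sum_le (I : finType) (F : I -> 'rV[R]_n) :
  enorm (\sum_i F i) <= \sum_i enorm (F i).
Proof.
elim/big_rec2: _ => [|i y z _ le_zy]; first by rewrite enorm0.
by rewrite (le_trans (enormD_le _ _))// lerD2l.
Qed.

Lemma enorm_dist_le u v : `|enorm u - enorm v| <= enorm (u - v).
Proof.
have := enormD_le (u - v) v; have := enormD_le (v - u) u.
rewrite !subrK (enormB v u) ler_norml; lra.
Qed.

Lemma coord_le_enorm v i : `|v 0 i| <= enorm v.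
Proof.
rewrite -sqrtr_sqr ler_sqrt ?edot_ge0// /edot (bigD1 i)//= -expr2 lerDl.
by apply: sumr_ge0 => k _; rewrite -expr2 sqr_ge0.
Qed.

Lemma row_norm_le v a : 0 <= a ->
  (forall i, `|v 0 i| <= a) -> `|v| <= a.
Proof.
move=> a0 va; rewrite [leLHS](_ : _ = mx_norm v)// mx_normrE.
by apply: bigmax_le => // -[i j] _ /=; rewrite ord1.
Qed.

Lemma coord_le_norm v i : `|v 0 i| <= `|v|.
Proof.
rewrite [leRHS](_ : _ = mx_norm v)// mx_normrE.
exact: (le_bigmax _ (fun ij : 'I_1 * 'I_n => `|v ij.1 ij.2|) (0, i)).
Qed.

(** The topology on row vectors comes from the max norm, so only equivalence of the two norms
    matters; the crude factor [n] serves as well as its square root. *)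
Lemma enorm_le_mx_norm v : enorm v <= n%:R * `|v|.
Proof.
rewrite -[leRHS]ger0_norm ?mulr_ge0// -sqrtr_sqr ler_sqrt ?sqr_ge0//.
rewrite exprMn; apply: (@le_trans _ _ (\sum_(k < n) `|v| ^+ 2)).
  apply: ler_sum => i _; rewrite -expr2 -real_normK ?num_real//.
  by rewrite ler_pXn2r ?nnegrE ?coord_le_norm.
rewrite sumr_const card_ord -[leLHS]mulr_natl ler_wpM2r ?sqr_ge0//.
by rewrite -natrX ler_nat; case: (n) => // m; rewrite leq_pmulr.
Qed.

Lemma mx_norm_le_enorm v : `|v| <= enorm v.
Proof. by apply: row_norm_le => [|i]; rewrite ?enorm_ge0 ?coord_le_enorm. Qed.

Lemma enorm_continuous : continuous (@enorm R n).
Proof.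
move=> v; apply/(@cvgrPdist_le _ _ _ _ (nbhs_filter v)) => e e0; apply/(@nbhs_normP R 'rV[R]_n).
(* The summand [1] keeps the divisor positive even for [n = 0]. *)
have n1 : 0 < n%:R + 1 :> R by rewrite ltr_wpDl.
exists (e / (n%:R + 1)) => [|u /= /ltW]; first by rewrite /= divr_gt0.
rewrite ler_pdivlMr// => le_uv.
rewrite (le_trans (enorm_dist_le _ _))// (le_trans (enorm_le_mx_norm _))//.
by rewrite (le_trans _ le_uv)// mulrC ler_wpM2l// lerDl.
Qed.

Lemma enorm_shift_continuous v :
  continuous (fun x : 'rV[R]_n => enorm (x - v)).
Proof.
move=> x; apply: (@continuous_comp _ _ _ (fun x : 'rV[R]_n => x - v) (@enorm R n) x).
  by apply: (@continuousB R 'rV[R]_n 'rV[R]_n id (cst v) x); [exact: cvg_id|exact: cst_continuous].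
exact: enorm_continuous.
Qed.

End EuclideanNorm.

(** * Derivatives along curves *)

Section Calculus.
Context {R : realType}.
Implicit Types (f g : R -> R) (t : R).

Lemma is_derive_add f g t a b : is_derive t 1 f a -> is_derive t 1 g b ->
  is_derive t 1 (fun s => f s + g s) (a + b).
Proof. by move=> df dg; exact: is_deriveD. Qed.

Lemma is_derive_sub f g t a b : is_derive t 1 f a -> is_derive t 1 g b ->
  is_derive t 1 (fun s => f s - g s) (a - b).
Proof. by move=> df dg; exact: is_deriveB. Qed.

Lemma is_derive_mul f g t a b : is_derive t 1 f a -> is_derive t 1 g b ->
  is_derive t 1 (fun s => f s * g s) (a * g t + f t * b).
Proof.
move=> df dg; apply: is_derive_eq (is_deriveM df dg) _.
by rewrite /GRing.scale/= addrC mulrC.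
Qed.

Lemma is_derive_const t (c : R) : is_derive t 1 (fun=> c) 0.
Proof. exact: is_derive_cst. Qed.

Lemma is_derive_mull c f t a : is_derive t 1 f a ->
  is_derive t 1 (fun s => c * f s) (c * a).
Proof. by move=> df; exact: is_deriveZ. Qed.

Lemma is_derive_bigsum (I : finType) (F : I -> R -> R) (dF : I -> R) t :
  (forall i, is_derive t 1 (F i) (dF i)) ->
  is_derive t 1 (fun s => \sum_i F i s) (\sum_i dF i).
Proof.
move=> dFi; elim: (index_enum I) => [|i s ds].
  rewrite big_nil (_ : (fun _ => _) = fun=> 0); first exact: is_derive_const.
  by apply/funext => s; rewrite big_nil.
rewrite big_cons (_ : (fun _ => _) = fun u => F i u + \sum_(i <- s) F i u).
  exact: is_derive_add.
by apply/funext => u; rewrite big_cons.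
Qed.

Lemma is_derive_sin_comp f t a : is_derive t 1 f a ->
  is_derive t 1 (fun s => sin (f s)) (cos (f t) * a).
Proof. by move=> df; exact: (is_derive1_comp (is_derive_sin _) df). Qed.

Lemma is_derive_cos_comp f t a : is_derive t 1 f a ->
  is_derive t 1 (fun s => cos (f s)) (- sin (f t) * a).
Proof. by move=> df; exact: (is_derive1_comp (is_derive_cos _) df). Qed.

Lemma is_derive_expR_mull (k t : R) :
  is_derive t 1 (fun s => expR (k * s)) (k * expR (k * t)).
Proof.
apply: is_derive_eq
  (is_derive1_comp (is_derive_expR _) (is_derive_mull k (is_derive_id t 1))) _.
by rewrite mulr1; exact: mulrC.
Qed.

Lemma is_derive_continuous f t a : is_derive t 1 f a -> {for t, continuous f}.
Proof. by move=> [df _]; apply: differentiable_continuous; exact/derivable1_diffP. Qed.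

Lemma is_derive_rowP n (x : R -> 'rV[R]_n) (v : 'rV[R]_n) t :
  is_derive t 1 x v <-> forall i, is_derive t 1 (fun s => x s 0 i) (v 0 i).
Proof.
split=> [[dx <-] i|dx].
  rewrite derive_mx// mxE; apply: DeriveDef => //.
  exact: (derivable_mxP _ _ _).1.
have dx' : derivable x t 1.
  by apply/derivable_mxP => i j; rewrite ord1; case: (dx j).
apply: DeriveDef => //; rewrite derive_mx//; apply/rowP => i; rewrite mxE.
by case: (dx i).
Qed.

Lemma differentiable_edot_grad n (f : 'rV[R]_n -> R) x v : differentiable f x ->
  'D_v f x = edot (grad f x) v.
Proof.
move=> df; rewrite deriveE// [v in LHS]row_sum_delta linear_sum.
apply: eq_bigr => i _; rewrite linearZ/= /GRing.scale/= mulrC mxE /partial.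
by rewrite deriveE.
Qed.

Lemma is_derive_row_comp n (f : 'rV[R]_n -> R) (x : R -> 'rV[R]_n) v t :
  differentiable f (x t) -> is_derive t 1 x v ->
  is_derive t 1 (fun s => f (x s)) (edot (grad f (x t)) v).
Proof.
move=> df dx; have dx' : differentiable x t.
  by apply/derivable1_diffP; case: dx.
have dfx : differentiable (f \o x) t by exact: differentiable_comp.
apply: DeriveDef; first exact/derivable1_diffP.
rewrite deriveE// diff_comp//= -differentiable_edot_grad// deriveE//.
by congr ('d f (x t) _); rewrite -deriveE//; case: dx.
Qed.

Lemma le_of_is_derive f df a b c : a <= b ->
  (forall t, a <= t <= b -> is_derive t 1 f (df t)) ->
  (forall t, a <= t <= b -> df t <= c) -> f b - f a <= c * (b - a).
Proof.
move=> ab dfE dfc; have [||u uab ->] := @MVT_segment R f df a b ab.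
- by move=> u; rewrite in_itv/= => /andP[au ub]; apply: dfE; rewrite !ltW.
- apply: continuous_in_subspaceT => u; rewrite inE/= in_itv/= => uab.
  by apply: is_derive_continuous; exact: dfE.
by rewrite ler_wpM2r ?subr_ge0//; apply: dfc; rewrite in_itv/= in uab.
Qed.

Lemma increment_le f df g dg a b : a <= b ->
  (forall t, a <= t <= b -> is_derive t 1 f (df t)) ->
  (forall t, a <= t <= b -> is_derive t 1 g (dg t)) ->
  (forall t, a <= t <= b -> df t <= dg t) -> f b - f a <= g b - g a.
Proof.
move=> ab dfE dgE dfg.
have := @le_of_is_derive (fun s => f s - g s) (fun s => df s - dg s) a b 0 ab.
rewrite mul0r => H; suff : f b - g b - (f a - g a) <= 0 by lra.
apply: H => t tab; first by apply: is_derive_sub; [exact: dfE|exact: dgE].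
by have := dfg t tab; lra.
Qed.

Lemma increment_norm_le f df g dg a b : a <= b ->
  (forall t, a <= t <= b -> is_derive t 1 f (df t)) ->
  (forall t, a <= t <= b -> is_derive t 1 g (dg t)) ->
  (forall t, a <= t <= b -> `|df t| <= dg t) -> `|f b - f a| <= g b - g a.
Proof.
move=> ab dfE dgE dfg.
have le_f : f b - f a <= g b - g a.
  apply: (@increment_le f df g dg) => // t tab.
  by rewrite (le_trans (ler_norm _))// dfg.
have dNf t : a <= t <= b -> is_derive t 1 (fun s => - f s) (- df t).
  by move=> tab; apply: is_deriveN; exact: dfE.
have : - f b - - f a <= g b - g a.
  apply: (@increment_le _ _ g dg _ _ ab dNf) => // t tab.
  by rewrite (le_trans (ler_norm _))// normrN dfg.
by rewrite ler_norml le_f andbT; lra.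
Qed.

Lemma derive_ge0_at_left_max f df a t : a < t -> is_derive t 1 f df ->
  (forall s, a <= s <= t -> f s <= f t) -> 0 <= df.
Proof.
move=> at_ [dft <-] fmax; rewrite leNgt; apply/negP => D_lt0.
have : \forall h \near (0 : R)^', h^-1 *: (f (h *: 1 + t) - f t) < 0.
  by apply: (cvgr_lt _ dft).
move=> /nbhs_ballP[e /= e0 He].
(* [t - h] lies both in the ball where the difference quotient is negative and in [[a, t]]; there
   the quotient at [- h] is nonnegative by maximality of [f t]. *)
pose h := Num.min (e / 2) (t - a).
have h0 : 0 < h by rewrite lt_min divr_gt0//= subr_gt0.
have he : h <= e / 2 by rewrite ge_min lexx.
have ha : h <= t - a by rewrite ge_min lexx orbT.
have := He (- h); rewrite /ball/= sub0r opprK (gtr0_norm h0) oppr_eq0.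
have {}he : h < e by lra.
move=> /(_ he (lt0r_neq0 h0)).
rewrite /GRing.scale/= mulr1 invrN mulNr oppr_lt0 pmulr_rgt0 ?invr_gt0// subr_gt0.
by rewrite ltNge fmax//; lra.
Qed.

Lemma antiderivative f : continuous f ->
  exists F : R -> R, F 0 = 0 /\ forall t, 0 <= t -> is_derive t 1 F (f t).
Proof.
move=> cf.
(* Integration starts at [-1], so that [0] is an interior point and the derivative there is
   two-sided. *)
pose F x : R := (\int[lebesgue_measure]_(t in [set` `[-1, x]]) f t)%R.
exists (fun x => F x - F 0); split; first by rewrite subrr.
move=> t t0; rewrite -[f t]subr0; apply: (@is_derive_sub F (fun=> F 0)).
have intf u : lebesgue_measure.-integrable `[-1, u] (EFin \o f).
  apply: continuous_compact_integrable; first exact: segment_compact.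
  by apply: continuous_subspaceT.
have [||dF F'] := @continuous_FTC1_closed R f (-1) t (t + 1) _ (intf _) _ (cf t).
- by rewrite ltrDl.
- by rewrite (lt_le_trans _ t0)// ltrN10.
have DF : 'D_1 (F : R -> R) t = f t by rewrite -derive1E; exact: F'.
exact: (DeriveDef dF DF).
Qed.

End Calculus.

(** * Existence and uniqueness of solutions *)

Section Picard.
Context {R : realType}.

Lemma row_increment_norm_le n (x dx : R -> 'rV[R]_n) (g dg : R -> R) (a b : R) : a <= b ->
  (forall t, a <= t <= b -> is_derive t 1 x (dx t)) ->
  (forall t, a <= t <= b -> is_derive t 1 g (dg t)) ->
  (forall t, a <= t <= b -> `|dx t| <= dg t) -> `|x b - x a| <= g b - g a.
Proof.
move=> ab dxE dgE dxg.
have coord_le i : `|(x b - x a) 0 i| <= g b - g a.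
  rewrite !mxE; apply: (@increment_norm_le R (fun t => x t 0 i)
    (fun t => dx t 0 i) g dg) => // t tab.
  - by have /is_derive_rowP := dxE t tab.
  - by rewrite (le_trans (coord_le_norm _ _))// dxg.
apply: row_norm_le => //.
have := @increment_le R (fun=> 0) (fun=> 0) g dg a b ab.
rewrite subrr; apply => // t tab.
by rewrite (le_trans _ (dxg t tab)).
Qed.

(** The intervals around [u k] of radius [c * 2^-1 ^+ k * 2] are nested, because the radius shrinks
    by at least the size of the next increment; the supremum of their left ends lies in all of
    them. *)
Lemma geometric_limit (u : nat -> R) (c : R) :
  (forall k, `|u k.+1 - u k| <= c * 2^-1 ^+ k) ->
  exists l, forall k, `|u k - l| <= c * 2^-1 ^+ k * 2.
Proof.
move=> uS; have geomS k : c * 2^-1 ^+ k.+1 = c * 2^-1 ^+ k / 2.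
  by rewrite exprSr mulrA.
pose lo k := u k - c * 2^-1 ^+ k * 2; pose hi k := u k + c * 2^-1 ^+ k * 2.
have loS : {homo lo : i j / (i <= j)%N >-> i <= j}.
  apply/nondecreasing_seqP => k; have := uS k; rewrite /lo geomS ler_norml.
  by move=> /andP[]; lra.
have hiS : {homo hi : i j / (i <= j)%N >-> j <= i}.
  apply/nonincreasing_seqP => k; have := uS k; rewrite /hi geomS ler_norml.
  by move=> /andP[]; lra.
have lohi j k : lo j <= hi k.
  apply: (le_trans (loS _ _ (leq_maxl j k))).
  apply: le_trans (hiS _ _ (leq_maxr j k)).
  have := uS (maxn j k) => /(le_trans (normr_ge0 _)).
  by rewrite /lo /hi; lra.
exists (sup (range lo)) => k.
have lo_le : lo k <= sup (range lo).
  by apply: ub_le_sup; [exists (hi 0%N) => _ [j _ <-]|exists k].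
have le_hi : sup (range lo) <= hi k.
  by apply: ge_sup; [exists (lo 0%N), 0%N|move=> _ [j _ <-]].
by move: lo_le le_hi; rewrite /lo /hi ler_norml => *; apply/andP; split; lra.
Qed.

Lemma small_geometric (c e : R) : 0 < e -> exists k, c * 2^-1 ^+ k <= e.
Proof.
move=> e0; have [c0|c0] := leP c 0.
  by exists 0%N; rewrite expr0 mulr1 (le_trans c0)// ltW.
have : (2^-1 : R) ^+ k @[k --> \oo] --> 0.
  by apply: cvg_expr; rewrite ger0_norm// invf_lt1// ltr1n.
move=> /cvgrPdist_le/(_ (e / c) (divr_gt0 e0 c0)) [k _ /(_ k (leqnn k))] /=.
rewrite sub0r normrN.
by move=> /(le_trans (ler_norm _)); rewrite ler_pdivlMr// mulrC; exists k.
Qed.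

Lemma max0_continuous : continuous (fun t : R => Num.max 0 t).
Proof.
move=> t; apply: (@continuous_max R R (cst 0) id t); first exact: cst_continuous.
exact: cvg_id.
Qed.

(** Primitives are controlled only for [t >= 0]. Freezing them at negative times gives continuous
    functions on the whole line, the space in which the Picard iteration runs. *)
Lemma clamp_continuous n (y dy : R -> 'rV[R]_n) :
  (forall t : R, 0 <= t -> is_derive t 1 y (dy t)) ->
  continuous (fun t : R => y (Num.max 0 t)).
Proof.
move=> yE t; apply: (@continuous_comp R R 'rV[R]_n (fun s => Num.max 0 s) y t).
  exact: max0_continuous.
apply: differentiable_continuous; apply/derivable1_diffP.
by have := yE (Num.max 0 t); rewrite le_max lexx => -[].
Qed.

Lemma row_primitive n (g : R -> 'rV[R]_n) x0 : continuous g ->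
  exists y : R -> 'rV[R]_n, y 0 = x0 /\ forall t : R, 0 <= t -> is_derive t 1 y (g t).
Proof.
move=> cg; have cgi i : continuous (fun t => g t 0 i).
  by move=> t; apply: (@continuous_comp _ _ _ g (fun v : 'rV[R]_n => v 0 i));
    [exact: cg|exact: coord_continuous].
have /choice[F FE] i := antiderivative (cgi i).
exists (fun t => x0 + \row_i F i t); split=> [|t t0].
  by apply/rowP => i; rewrite !mxE (FE i).1 addr0.
apply/is_derive_rowP => i; rewrite (_ : (fun _ => _) = fun s => x0 0 i + F i s).
  rewrite -[g t 0 i]add0r; apply: is_derive_add.
  exact: (FE i).2.
by apply/funext => s; rewrite !mxE.
Qed.

(* Picard iteration, contracting by 1/2 for the norm weighted by exp(- 2 K t). *)
Lemma global_solution n (f : R -> 'rV[R]_n -> 'rV[R]_n) (K B : R) x0 : 0 < K ->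
  (forall x : R -> 'rV[R]_n, continuous x -> continuous (fun t => f t (x t))) ->
  (forall t x y, `|f t x - f t y| <= K * `|x - y|) ->
  (forall t x, `|f t x| <= B) ->
  exists x : R -> 'rV[R]_n, x 0 = x0 /\
    forall t : R, 0 <= t -> is_derive t 1 x (f t (x t)).
Proof.
move=> K0 cf fK fB.
pose E (t : R) : R := expR (2 * K * Num.max 0 t).
have E_gt0 (t : R) : 0 < E t by exact: expR_gt0.
have dE (t : R) := is_derive_expR_mull (2 * K) t.
have /choice[P PE] (x : {x : R -> 'rV[R]_n | continuous x}) :
    exists y : R -> 'rV[R]_n, y 0 = x0 /\
      forall t : R, 0 <= t -> is_derive t 1 y (f t (sval x t)).
  by apply: row_primitive; apply: cf; exact: (svalP x).
pose next (x : {x : R -> 'rV[R]_n | continuous x}) : {x : R -> 'rV[R]_n | continuous x} :=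
  exist _ _ (clamp_continuous (PE x).2).
(* The integral of [K * c * expR (2 * K * s)] over [[0, t]] is at most [c / 2 * expR (2 * K * t)]:
   the weight is what yields the factor 1/2 on the whole half-line. *)
have P_contract (x y : {x : R -> 'rV[R]_n | continuous x}) c : 
    (forall t, `|sval x t - sval y t| <= c * E t) ->
    forall t, 0 <= t -> `|P x t - P y t| <= c / 2 * E t.
  move=> xy t t0.
  have c0 : 0 <= c by rewrite -(pmulr_lge0 _ (E_gt0 0)) (le_trans _ (xy 0)).
  have := @row_increment_norm_le _ (fun s => P x s - P y s)
    (fun s => f s (sval x s) - f s (sval y s))
    (fun s => c / 2 * expR (2 * K * s)) (fun s => c / 2 * (2 * K * expR (2 * K * s)))
    0 t t0.
  rewrite (PE x).1 (PE y).1 subrr subr0 mulr0 expR0 mulr1 => H.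
  rewrite (le_trans (H _ _ _))//.
  - move=> s /andP[s0 _]; apply/is_derive_rowP => i.
    rewrite (_ : (fun _ => _) = fun s => P x s 0 i - P y s 0 i); last first.
      by apply/funext => u; rewrite !mxE.
    rewrite !mxE; apply: is_derive_sub.
      by have /is_derive_rowP := (PE x).2 s s0.
    by have /is_derive_rowP := (PE y).2 s s0.
  - move=> s /andP[s0 _]; rewrite (le_trans (fK _ _ _))//.
    rewrite (le_trans (ler_wpM2l (ltW K0) (xy s)))// /E max_r//.
    by rewrite le_eqVlt; apply/orP; left; apply/eqP; field.
  - by rewrite /E max_r// lerBlDr lerDl divr_ge0.
have cst_cont : continuous (fun _ : R => x0) by exact: cst_continuous.
pose z k := iter k next (exist _ (fun=> x0) cst_cont).
have zS k t : sval (z k.+1) t = P (z k) (Num.max 0 t) by [].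
have E_max t : E t = E (Num.max 0 t) by rewrite /E maxA maxxx.
have B0 : 0 <= B by rewrite (le_trans (normr_ge0 _) (fB 0 0)).
(* [M] makes the derivative of [M * expR (2 * K * u)] at least [B], which bounds the first Picard
   increment in the weighted norm. *)
have [M M0 BE] : exists2 M, 0 <= M & B = M * (2 * K).
  exists (B / (2 * K)); first by rewrite divr_ge0// mulr_ge0// ltW.
  by rewrite divfK// mulf_neq0// gt_eqF.
have zE k t : `|sval (z k.+1) t - sval (z k) t| <= M * E t * 2^-1 ^+ k.
  elim: k t => [|k IHk] t; last first.
    rewrite !zS [leRHS](_ : _ = M * 2^-1 ^+ k / 2 * E t); last by rewrite exprSr; ring.
    rewrite E_max.
    apply: P_contract; last by rewrite le_max lexx.
    by move=> s; rewrite mulrAC.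
  rewrite zS E_max expr0 mulr1; set s := Num.max 0 t.
  have s0 : 0 <= s by rewrite le_max lexx.
  have := @row_increment_norm_le _ _ _ (fun u => M * expR (2 * K * u))
    (fun u => M * (2 * K * expR (2 * K * u))) 0 s s0
    (fun u us => (PE (z 0%N)).2 u (andP us).1).
  rewrite (PE (z 0%N)).1 mulr0 expR0 mulr1 => H.
  rewrite (le_trans (H _ _))//.
  - move=> u /andP[u0 _]; rewrite (le_trans (fB _ _))//.
    rewrite [leRHS](_ : _ = B * expR (2 * K * u)); last by rewrite BE mulrA.
    by rewrite ler_peMr// -expR0 ler_expR !mulr_ge0// ltW.
  - by rewrite /E max_r// lerBlDr lerDl.
have zlim t i : exists l, forall k,
    `|sval (z k) t 0 i - l| <= M * E t * 2^-1 ^+ k * 2.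
  apply: geometric_limit => k.
  by have := le_trans (coord_le_norm _ i) (zE k t); rewrite !mxE; apply.
have [w wE] : exists w : R -> 'rV[R]_n, forall k t,
    `|sval (z k) t - w t| <= M * E t * 2^-1 ^+ k * 2.
  have /choice[l lE] (t : R) : exists l : 'I_n -> R, forall i k,
      `|sval (z k) t 0 i - l i| <= M * E t * 2^-1 ^+ k * 2.
    by have [l lE] := choice (zlim t); exists l.
  exists (fun t => \row_i l t i) => k t; apply: row_norm_le => [|i].
    by rewrite !mulr_ge0 ?exprn_ge0 ?(ltW (E_gt0 t)).
  have -> : (sval (z k) t - \row_j l t j) 0 i = sval (z k) t 0 i - l t i by rewrite !mxE.
  exact: lE.
have Econt : continuous E.
  move=> t; apply: (@continuous_comp R R R (fun s => Num.max 0 s)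
      (fun s => expR (2 * K * s)) t).
    exact: max0_continuous.
  exact: is_derive_continuous (is_derive_expR_mull _ _).
have wcont : continuous w.
  move=> t; apply/(@cvgrPdist_le _ _ _ _ (nbhs_filter t)) => e e0.
  have e4 : 0 < e / 3 by rewrite divr_gt0.
  (* One index [k] serves all [s] near [t], since the tail bound is uniform where [E s <= E t + 1];
     a limit of this kind is continuous. *)
  have [k ke] := small_geometric (M * (E t + 1) * 2) e4.
  have kc : continuous (sval (z k)) by exact: (svalP (z k)).
  have /(@cvgrPdist_le _ _ _ _ (nbhs_filter t))/(_ _ e4) zk := kc t.
  have /(@cvgrPdist_le _ _ _ _ (nbhs_filter t))/(_ _ ltr01) Ek := Econt t.
  near=> s.
  have near_w u : E u <= E t + 1 -> `|sval (z k) u - w u| <= e / 3.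
    move=> Eu; rewrite (le_trans (wE k u))// (le_trans _ ke)//.
    by rewrite [leRHS]mulrAC ler_wpM2r// ler_wpM2r ?exprn_ge0// ler_wpM2l.
  have ws : `|sval (z k) s - w s| <= e / 3.
    apply: near_w; have : `|E t - E s| <= 1 by near: s; exact: Ek.
    by rewrite ler_norml => /andP[]; lra.
  have wt : `|sval (z k) t - w t| <= e / 3 by apply: near_w; rewrite lerDl.
  have zts : `|sval (z k) t - sval (z k) s| <= e / 3 by near: s; exact: zk.
  rewrite (_ : w t - w s = - (sval (z k) t - w t) +
    (sval (z k) t - sval (z k) s) + (sval (z k) s - w s)); last first.
    by rewrite opprB !addrA !subrK.
  rewrite (le_trans (ler_normD _ _))//.
  have := ler_normD (- (sval (z k) t - w t)) (sval (z k) t - sval (z k) s).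
  by rewrite normrN; lra.
pose W : {x : R -> 'rV[R]_n | continuous x} := exist _ w wcont.
exists (P W); split=> [|t t0]; first exact: (PE W).1.
(* [w] is a fixed point: at nonnegative times [z k.+1] is [P (z k)], and it is close both to [w]
   and, by contraction, to [P W]. *)
suff -> : P W t = w t by exact: (PE W).2.
apply/eqP; rewrite -subr_eq0 -normr_le0; apply/ler_addgt0Pl => e e0; rewrite addr0.
have [k ke] := small_geometric (M * E t * 2) e0.
rewrite (le_trans _ ke)//.
have zt := wE k.+1 t; rewrite zS max_r// in zt.
have PWz : `|P W t - P (z k) t| <= M * 2^-1 ^+ k * 2 / 2 * E t.
  apply: P_contract => // s; rewrite distrC (le_trans (wE k s))//.
  by rewrite le_eqVlt; apply/orP; left; apply/eqP; ring.
rewrite exprSr in zt.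
have := ler_normD (P W t - P (z k) t) (P (z k) t - w t).
rewrite addrA subrK => /le_trans; apply.
apply: (le_trans (lerD PWz zt)).
by rewrite le_eqVlt; apply/orP; left; apply/eqP; field.
Unshelve. all: by end_near. Qed.
End Picard.

(** * Uniqueness by a Gronwall estimate *)

Section Uniqueness.
Context {R : realType}.

Lemma is_derive_edot n (x y : R -> 'rV[R]_n) u v (t : R) :
  is_derive t 1 x u -> is_derive t 1 y v ->
  is_derive t 1 (fun s => edot (x s) (y s)) (edot u (y t) + edot (x t) v).
Proof.
move=> /is_derive_rowP dx /is_derive_rowP dy; rewrite -big_split.
exact: (is_derive_bigsum (fun k => is_derive_mul (dx k) (dy k))).
Qed.

(** The squared distance times [expR (- (2 * K) * t)] has nonpositive derivative inside the interval
    and vanishes at [0]; by the mean value theorem it is nonpositive at [T]. *)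
Lemma ode_unique n (f : R -> 'rV[R]_n -> 'rV[R]_n) (K T : R) (x y : R -> 'rV[R]_n) :
  (forall t u v, enorm (f t u - f t v) <= K * enorm (u - v)) ->
  {within `[0, T], continuous x} -> {within `[0, T], continuous y} ->
  (forall t, 0 < t < T -> is_derive t 1 x (f t (x t))) ->
  (forall t, 0 < t < T -> is_derive t 1 y (f t (y t))) ->
  x 0 = y 0 -> 0 <= T -> x T = y T.
Proof.
move=> fK cx cy dx dy xy0 T0; pose d t := x t - y t.
pose N t := edot (d t) (d t) * expR (- (2 * K) * t).
pose dN t := (edot (f t (x t) - f t (y t)) (d t) + edot (d t) (f t (x t) - f t (y t))) *
    expR (- (2 * K) * t) + edot (d t) (d t) * (- (2 * K) * expR (- (2 * K) * t)).
have [||c _ NT] := @MVT_segment R N dN 0 T T0.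
- move=> t; rewrite in_itv/= => tT.
  apply: is_derive_mul (is_derive_expR_mull _ _).
  by apply: is_derive_edot; apply: is_deriveB; [exact: dx|exact: dy|exact: dx|exact: dy].
- have cd : {within `[0, T], continuous (fun t => enorm (d t))}.
    move=> t; apply: (@continuous_comp (subspace `[0, T]) 'rV[R]_n R d (@enorm R n) t).
      by apply: continuousB; [exact: cx|exact: cy].
    exact: enorm_continuous.
  have -> : N = fun t => enorm (d t) * enorm (d t) * expR (- (2 * K) * t).
    by apply/funext => t; rewrite /N -sqr_enorm.
  have ce : {within `[0, T], continuous (fun t => expR (- (2 * K) * t))}.
    apply: continuous_subspaceT => t.
    exact: is_derive_continuous (is_derive_expR_mull _ _).
  move=> t; apply: (@continuousM R (subspace `[0, T])
    (fun t => enorm (d t) * enorm (d t)) _ t); last exact: ce.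
  by apply: (@continuousM R (subspace `[0, T])); exact: cd.
have dN_le0 : dN c <= 0.
  rewrite /dN (edotC (d c)) -sqr_enorm.
  rewrite [leLHS](_ : _ = 2 * expR (- (2 * K) * c) *
    (edot (f c (x c) - f c (y c)) (d c) - K * enorm (d c) ^+ 2)); last by ring.
  rewrite pmulr_rle0 ?mulr_gt0 ?expR_gt0// subr_le0.
  rewrite (le_trans (edot_le_enorm _ _))//.
  rewrite [leRHS](_ : _ = K * enorm (d c) * enorm (d c)); last by ring.
  by rewrite ler_wpM2r ?enorm_ge0//; exact: fK.
have : N T <= 0.
  move: NT; rewrite {2}/N /d xy0 subrr edot0l mul0r !subr0 => ->.
  by rewrite mulr_le0_ge0.
rewrite pmulr_lle0 ?expR_gt0// -sqr_enorm => dT.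
apply/eqP; rewrite -subr_eq0; apply/eqP; apply: enorm_eq0; apply/eqP.
by rewrite -sqrf_eq0 eq_le dT sqr_ge0.
Qed.

End Uniqueness.

(** * Primitives of products of trigonometric functions *)

Section TrigonometricPrimitives.
Context {R : realType}.
Implicit Types (p q r s a b w t : R).

Definition trig (j : 'I_2) (a : R) : R := if j == 0 then cos a else sin a.

Definition trig_primitive (j : 'I_2) (a : R) : R := if j == 0 then sin a else - cos a.

Lemma trig_le1 j a : `|trig j a| <= 1.
Proof.
by rewrite /trig ler_norml; case: ifP; rewrite ?cos_geN1 ?cos_le1 ?sin_geN1 ?sin_le1.
Qed.

Lemma trig_primitive_le1 j a : `|trig_primitive j a| <= 1.
Proof.
have [ss cc] := (trig_le1 1 a, trig_le1 0 a).
by rewrite /trig_primitive; case: ifP => _; rewrite ?normrN.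
Qed.

Lemma is_derive_trig_primitive j (f : R -> R) t a : is_derive t 1 f a ->
  is_derive t 1 (fun s => trig_primitive j (f s)) (a * trig j (f t)).
Proof.
move=> df; rewrite mulrC /trig_primitive /trig; case: ifP => _.
  exact: is_derive_sin_comp.
rewrite -[sin _]opprK mulNr; apply: is_deriveN; exact: is_derive_cos_comp.
Qed.

(** The general bilinear form in the cosine and sine of two angles. These forms are closed under
    differentiation in either angle, so a primitive is found by solving linear equations for
    [p q r s]. *)
Definition trig_form p q r s a b : R :=
  p * (cos a * cos b) + q * (cos a * sin b) +
  r * (sin a * cos b) + s * (sin a * sin b).

Lemma trig_form_le p q r s a b :
  `|trig_form p q r s a b| <= `|p| + `|q| + `|r| + `|s|.
Proof.
have H (c : R) i j : `|c * (trig i a * trig j b)| <= `|c|.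
  by rewrite !normrM ler_piMr// mulr_ile1// trig_le1.
have := H p 0 0; have := H q 0 1; have := H r 1 0; have := H s 1 1.
rewrite /trig/= => Hs Hr Hq Hp.
by do 3!(apply: (le_trans (ler_normD _ _)); apply: lerD => //).
Qed.

Lemma is_derive_trig_form p q r s (f g : R -> R) t a b :
  is_derive t 1 f a -> is_derive t 1 g b ->
  is_derive t 1 (fun x => trig_form p q r s (f x) (g x))
    (a * trig_form r s (- p) (- q) (f t) (g t) + b * trig_form q (- p) s (- r) (f t) (g t)).
Proof.
move=> df dg.
have dcf := is_derive_cos_comp df; have dsf := is_derive_sin_comp df.
have dcg := is_derive_cos_comp dg; have dsg := is_derive_sin_comp dg.
apply: is_derive_eq (is_derive_add (is_derive_add (is_derive_add
  (is_derive_mull p (is_derive_mul dcf dcg)) (is_derive_mull q (is_derive_mul dcf dsg)))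
  (is_derive_mull r (is_derive_mul dsf dcg))) (is_derive_mull s (is_derive_mul dsf dsg))) _.
by rewrite /trig_form; ring.
Qed.

Lemma ord2_neq0 (j : 'I_2) : j != 0 -> j = 1.
Proof. by case: j => [[|[|//]] ?] // _; exact: val_inj. Qed.

(** The left side is the derivative in [tau] of [trig_form p q r s a b]. The subtracted constant is
    the mean of the product: 1/2 for the square of one wave, 0 for different frequencies or for
    cosine against sine. *)
Lemma trig_form_primitive w1 w2 (j1 j2 : 'I_2) : 0 < w1 -> 0 < w2 ->
  exists p q r s, forall u tau, let a := u + w1 * tau in let b := u + w2 * tau in
    w1 * trig_form r s (- p) (- q) a b + w2 * trig_form q (- p) s (- r) a b =
    trig j1 a * trig j2 b - (if (w1 == w2) && (j1 == j2) then 1 / 2 else 0).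
Proof.
move=> w1_gt0 w2_gt0; have [<-|w12] := eqVneq w1 w2.
  have w1_neq0 : w1 != 0 by rewrite gt_eqF.
  have c2 (a : R) : cos a * cos a = 1 - sin a * sin a.
    by rewrite -!expr2 -(cos2Dsin2 a) addrK.
  have [j10|j1_neq0] := eqVneq j1 0; have [j20|j2_neq0] := eqVneq j2 0.
  - exists 0, 0, (1 / (2 * w1)), 0 => u tau /=.
    by rewrite /trig /trig_form j10 j20/= c2; field.
  - exists 0, 0, 0, (1 / (2 * w1)) => u tau /=.
    rewrite /trig /trig_form j10 (negbTE j2_neq0) eq_sym (negbTE j2_neq0)/=.
    by field.
  - exists 0, 0, 0, (1 / (2 * w1)) => u tau /=.
    rewrite /trig /trig_form j20 (negbTE j1_neq0)/=.
    by field.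
  - rewrite (ord2_neq0 j1_neq0) (ord2_neq0 j2_neq0) eqxx.
    exists 0, 0, (- (1 / (2 * w1))), 0 => u tau /=.
    by rewrite /trig /trig_form/= c2; field.
(* For different frequencies the coefficients solve a linear system with this determinant, up to
   sign. *)
have D_neq0 : w1 ^+ 2 - w2 ^+ 2 != 0.
  by rewrite subr_sqr mulf_neq0 ?subr_eq0// lt0r_neq0// addr_gt0.
pose D := w1 ^+ 2 - w2 ^+ 2; rewrite /trig.
have [_|_] := eqVneq j1 0; have [_|_] := eqVneq j2 0.
- exists 0, (- w2 / D), (w1 / D), 0 => u tau; by rewrite /trig_form /D subr0; field.
- exists (w2 / D), 0, 0, (w1 / D) => u tau; by rewrite /trig_form /D subr0; field.
- exists (- w1 / D), 0, 0, (- w2 / D) => u tau; by rewrite /trig_form /D subr0; field.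
- exists 0, (- w1 / D), (w2 / D), 0 => u tau; by rewrite /trig_form /D subr0; field.
Qed.

(** [A] is the primitive in [tau]. Along a trajectory the phase [u], which will be the cost, moves
    as well; [B] is the derivative of [A] in [u], and only its boundedness is used. *)
Lemma trig_pair_primitive w1 w2 (j1 j2 : 'I_2) : 0 < w1 -> 0 < w2 ->
  exists (A B : R -> R -> R) (C : R),
    (forall u tau, `|A u tau| <= C /\ `|B u tau| <= C) /\
    forall (u tau : R -> R) (t du dtau : R),
      is_derive t 1 u du -> is_derive t 1 tau dtau ->
      is_derive t 1 (fun s => A (u s) (tau s))
        (dtau * (trig j1 (u t + w1 * tau t) * trig j2 (u t + w2 * tau t) -
                 (if (w1 == w2) && (j1 == j2) then 1 / 2 else 0)) +
         du * B (u t) (tau t)).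
Proof.
move=> w1_gt0 w2_gt0.
have [p [q [r [s E]]]] := trig_form_primitive j1 j2 w1_gt0 w2_gt0.
exists (fun u tau => trig_form p q r s (u + w1 * tau) (u + w2 * tau)).
exists (fun u tau => trig_form r s (- p) (- q) (u + w1 * tau) (u + w2 * tau) +
  trig_form q (- p) s (- r) (u + w1 * tau) (u + w2 * tau)).
exists ((`|p| + `|q| + `|r| + `|s|) * 2); split=> [u tau|u tau t du dtau dU dT].
  split; first by rewrite (le_trans (trig_form_le _ _ _ _ _ _))// ler_peMr// ler1n.
  rewrite (le_trans (ler_normD _ _))//.
  have := trig_form_le r s (- p) (- q) (u + w1 * tau) (u + w2 * tau).
  have := trig_form_le q (- p) s (- r) (u + w1 * tau) (u + w2 * tau).
  by rewrite !normrN; lra.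
apply: is_derive_eq (is_derive_trig_form p q r s
  (is_derive_add dU (is_derive_mull w1 dT)) (is_derive_add dU (is_derive_mull w2 dT))) _.
by rewrite -E; ring.
Qed.

End TrigonometricPrimitives.

(** * Averaging *)

Section Gradient.
Context {R : realType} {n : nat} (J : 'rV[R]_n -> R).

Lemma is_derive_grad (x : R -> 'rV[R]_n) v (t : R) :
  (forall i x, differentiable (partial J i) x) -> is_derive t 1 x v ->
  is_derive t 1 (fun s => grad J (x s)) (v *m (hess J (x t))^T).
Proof.
move=> dJ dx; apply/is_derive_rowP => i.
have -> : (v *m (hess J (x t))^T) 0 i = edot (grad (partial J i) (x t)) v.
  by rewrite mxE; apply: eq_bigr => j _; rewrite !mxE mulrC.
rewrite (_ : (fun _ => _) = fun s => partial J i (x s)).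
  exact: is_derive_row_comp.
by apply/funext => s; rewrite mxE.
Qed.

Lemma is_derive_line (y d : 'rV[R]_n) (t : R) : is_derive t 1 (fun s => y + s *: d) d.
Proof.
apply/is_derive_rowP => i.
rewrite (_ : (fun _ => _) = fun s => y 0 i + d 0 i * s); last first.
  by apply/funext => s; rewrite !mxE mulrC.
apply: is_derive_eq
  (is_derive_add (is_derive_const t (y 0 i)) (is_derive_mull (d 0 i) (is_derive_id t 1))) _.
by rewrite add0r mulr1.
Qed.

Lemma lipschitz_of_grad_le (M : R) : (forall x, differentiable J x) ->
  (forall x, enorm (grad J x) <= M) -> forall x y, J x - J y <= M * enorm (x - y).
Proof.
move=> dJ JM x y; pose d := x - y; have yd : y + d = x by rewrite addrC subrK.
have := @le_of_is_derive R (fun s => J (y + s *: d))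
  (fun s => edot (grad J (y + s *: d)) d) 0 1 (M * enorm d) ler01.
rewrite scale1r scale0r addr0 subr0 mulr1 yd; apply.
  by move=> t _; apply: is_derive_row_comp => //; exact: is_derive_line.
move=> t _; rewrite (le_trans (edot_le_enorm _ _))// ler_wpM2r ?enorm_ge0//.
Qed.

Lemma grad_lipschitz (L : R) : (forall i x, differentiable (partial J i) x) ->
  (forall x, opnorm_le (hess J x) L) ->
  forall x y, enorm (grad J x - grad J y) <= L * enorm (x - y).
Proof.
move=> dJ JL x y; pose d := x - y.
have yd : y + d = x by rewrite addrC subrK.
(* The mean value theorem is scalar, so the increment of the gradient is tested against itself and
   one factor [enorm u] is cancelled. *)
pose u := grad J x - grad J y.
have [->|u_neq0] := eqVneq (enorm u) 0.
  exact: le_trans (enorm_ge0 _) (JL x d).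
have u_gt0 : 0 < enorm u by rewrite lt_def u_neq0 enorm_ge0.
have := @le_of_is_derive R (fun s => edot (grad J (y + s *: d)) u)
  (fun s => edot (d *m (hess J (y + s *: d))^T) u) 0 1 (L * enorm d * enorm u) ler01.
rewrite scale1r scale0r addr0 subr0 mulr1 yd.
rewrite -edotBl -sqr_enorm expr2 ler_pM2r//; apply.
  move=> t _; apply: is_derive_eq (is_derive_edot (is_derive_grad dJ (is_derive_line y d t))
    (is_derive_cst u t 1)) _.
  by rewrite (edotC _ 0) edot0l addr0.
move=> t _; rewrite (le_trans (edot_le_enorm _ _))// ler_wpM2r ?enorm_ge0//.
exact: JL.
Qed.

End Gradient.

Ltac nonneg := repeat first
  [done | apply: mulr_ge0 | apply: addr_ge0 | apply: sumr_ge0 => ? _].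

(** * Second-order averaging and descent of the cost *)

Section Averaging.
Context {R : realType} {n : nat} {I : finType}.
Context (bb : I -> 'rV[R]_n) (w amplitude gain : I -> R) (jj : I -> 'I_2).
Context (b0 : 'rV[R]_n -> 'rV[R]_n) (J : 'rV[R]_n -> R) (gamma kappa LJ MJ : R).
Context (w_gt0 : forall m, 0 < w m)
  (wj_inj : forall m m', w m = w m' -> jj m = jj m' -> m = m').
Context (amplitude_ge0 : forall m, 0 <= amplitude m) (gain_ge0 : forall m, 0 <= gain m)
  (gain_freq : forall m, gain m * w m = amplitude m)
  (gain_amplitude : forall m, gain m * amplitude m = 2).
Context (gamma_kappa : kappa < gamma) (kappa_ge0 : 0 <= kappa)
  (LJ_ge0 : 0 <= LJ) (MJ_ge0 : 0 <= MJ).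
Context (excitation : forall v, gamma * enorm v ^+ 2 <= \sum_m edot (bb m) v ^+ 2).
Context (dJ : forall x, differentiable J x)
  (ddJ : forall i x, differentiable (partial J i) x)
  (hessJ : forall x, opnorm_le (hess J x) LJ)
  (gradJ : forall x, enorm (grad J x) <= MJ)
  (b0J : forall x, enorm (b0 x) <= kappa * enorm (grad J x)).

Definition wave m x tau : R := trig (jj m) (J x + w m * tau).
Definition slope m x : R := edot (grad J x) (bb m).

(** The Lie bracket average of the oscillating field: drift plus gradient descent weighted by the
    sum of the [bb m (bb m)^T]. *)
Definition averaged_field x := b0 x - \sum_m slope m x *: bb m.

#[local] Hint Extern 0 (is_true (0 <= enorm _)) => exact: enorm_ge0 : core.

Lemma slope_le m x : `|slope m x| <= MJ * enorm (bb m).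
Proof. by rewrite (le_trans (edot_norm_le _ _))// ler_wpM2r ?enorm_ge0. Qed.
Lemma drift_le x : enorm (b0 x) <= kappa * MJ.
Proof. by rewrite (le_trans (b0J x))// ler_wpM2l. Qed.

Definition es_trajectory (eps : R) (x : R -> 'rV[R]_n) (tau : R -> R) : Prop :=
  forall t : R, 0 <= t ->
    is_derive t 1 x (b0 (x t) + eps^-1 *: \sum_m (amplitude m * wave m (x t) (tau t)) *: bb m) /\
    is_derive t 1 tau (eps ^- 2).

(* The correction [z - x] is the primitive in [tau] of the oscillating part of
   the field, at the orders [eps] and [eps ^ 2]. *)
Lemma near_identity_transform : exists C0 C1, 0 <= C0 /\ 0 <= C1 /\
  forall (eps : R) x tau, 0 < eps -> eps <= 1 -> es_trajectory eps x tau ->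
  exists z : R -> 'rV[R]_n, forall t : R, 0 <= t ->
    enorm (z t - x t) <= C0 * eps /\
    exists e, enorm e <= C1 * eps /\ is_derive t 1 z (averaged_field (x t) + e).
Proof.
have /choice[ABC ABCE] (mm : I * I) : exists ABC : (R -> R -> R) * (R -> R -> R) * R,
    let A := ABC.1.1 in let B := ABC.1.2 in let C := ABC.2 in
    (forall u tau, `|A u tau| <= C /\ `|B u tau| <= C) /\
    forall (u tau : R -> R) (t du dtau : R),
      is_derive t 1 u du -> is_derive t 1 tau dtau ->
      is_derive t 1 (fun s => A (u s) (tau s))
        (dtau * (trig (jj mm.1) (u t + w mm.1 * tau t) *
                 trig (jj mm.2) (u t + w mm.2 * tau t) -
                 (if (w mm.1 == w mm.2) && (jj mm.1 == jj mm.2) then 1 / 2 else 0)) +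
         du * B (u t) (tau t)).
  have [A [B [C H]]] := trig_pair_primitive (jj mm.1) (jj mm.2) (w_gt0 mm.1) (w_gt0 mm.2).
  by exists (A, B, C).
pose A m m' := (ABC (m, m')).1.1; pose B m m' := (ABC (m, m')).1.2.
pose C m m' := (ABC (m, m')).2.
have A_le m m' u tau : `|A m m' u tau| <= C m m' by have [/(_ u tau)[]] := ABCE (m, m').
have B_le m m' u tau : `|B m m' u tau| <= C m m' by have [/(_ u tau)[]] := ABCE (m, m').
have C_ge0 m m' : 0 <= C m m' by rewrite (le_trans (normr_ge0 _) (A_le m m' 0 0)).
(* For [eps <= 1] the speed of the trajectory is at most [eps^-1 * S]. [K0 m] and [K1 m] bound
   [coef m] and [e m] below, each divided by [eps]. *)
have [S SE S_ge0] : exists2 S : R,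
    S = kappa * MJ + \sum_m amplitude m * enorm (bb m) & 0 <= S.
  by eexists; [reflexivity|nonneg].
pose K0 m := gain m + \sum_m' gain m * amplitude m' * (C m m' * (MJ * enorm (bb m'))).
pose K1 m := gain m * (MJ * (kappa * MJ)) + \sum_m' gain m * amplitude m' *
  (MJ * S * C m m' * (MJ * enorm (bb m')) + C m m' * (LJ * S * enorm (bb m'))).
have K0_ge0 m : 0 <= K0 m by nonneg.
have K1_ge0 m : 0 <= K1 m by nonneg.
exists (\sum_m K0 m * enorm (bb m)), (\sum_m K1 m * enorm (bb m)).
split; first by nonneg.
split; first by nonneg.
move=> eps x tau eps_gt0 eps_le1 traj.
have eps_neq0 : eps != 0 by rewrite gt_eqF.
have eps_ge0 := ltW eps_gt0.
have ieps_ge0 : 0 <= eps^-1 by rewrite invr_ge0.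
pose V m t := trig_primitive (jj m) (J (x t) + w m * tau t).
pose U m t := wave m (x t) (tau t).
pose AA m m' t := A m m' (J (x t)) (tau t).
pose BB m m' t := B m m' (J (x t)) (tau t).
pose D m t := slope m (x t).
pose coef m t := - eps * gain m * V m t +
  eps ^+ 2 * \sum_m' gain m * amplitude m' * (AA m m' t * D m' t).
exists (fun t => x t + \sum_m coef m t *: bb m) => t t0; split.
  rewrite addrC addKr (le_trans (enorm_sum_le _))// mulr_suml ler_sum// => m _.
  rewrite enormZ mulrAC ler_wpM2r ?enorm_ge0// /coef.
  rewrite (le_trans (ler_normD _ _))// mulrDl lerD//.
    rewrite !normrM normrN (gtr0_norm eps_gt0) (ger0_norm (gain_ge0 m)).
    by rewrite [leRHS]mulrC ler_piMr ?mulr_ge0 ?trig_primitive_le1// ltW.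
  rewrite normrM (ger0_norm (sqr_ge0 eps)) [leRHS]mulrC.
  rewrite ler_pM ?sqr_ge0//; first by rewrite expr2 ler_piMr// ltW.
  rewrite (le_trans (ler_norm_sum _ _ _))// ler_sum// => m' _.
  rewrite normrM ger0_norm ?mulr_ge0// ler_wpM2l ?mulr_ge0// normrM ler_pM//.
    exact: A_le.
  exact: slope_le.
have [dx dtau] := traj t t0.
set x' := (X in is_derive t 1 x X) in dx.
pose g := edot (grad J (x t)) x'.
pose D' m := edot (x' *m (hess J (x t))^T) (bb m).
have dJx : is_derive t 1 (fun s => J (x s)) g by exact: is_derive_row_comp.
have dD m : is_derive t 1 (D m) (D' m).
  rewrite /D /slope; apply: is_derive_eq
    (is_derive_edot (is_derive_grad ddJ dx) (is_derive_cst (bb m) t 1)) _.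
  by rewrite (edotC _ 0) edot0l addr0.
(* What survives in the derivative of [coef m] after the oscillating and averaged terms: the drift
   part of [g] multiplying [U m], and the derivatives of [A] in its phase and of [D]. *)
pose e m := - eps * gain m * edot (grad J (x t)) (b0 (x t)) * U m t +
  eps ^+ 2 * \sum_m' gain m * amplitude m' * (g * BB m m' t * D m' t + AA m m' t * D' m').
pose sU := \sum_m amplitude m * (U m t * D m t).
have gE : g = edot (grad J (x t)) (b0 (x t)) + eps^-1 * sU.
  rewrite /g edotDr edotZr edot_sumr; congr (_ + _ * _); apply: eq_bigr => m _.
  by rewrite edotZr mulrA.
have x'_le : enorm x' <= eps^-1 * S.
  rewrite SE (le_trans (enormD_le _ _))// mulrDr lerD//.
    by rewrite (le_trans (drift_le _))// ler_peMl ?mulr_ge0// invf_ge1.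
  rewrite enormZ ger0_norm// ler_wpM2l//.
  rewrite (le_trans (enorm_sum_le _))// ler_sum// => m _.
  rewrite enormZ ler_wpM2r ?enorm_ge0// normrM ger0_norm// ler_piMr// trig_le1//.
(* Differentiating [V m] produces [- eps^-1 * amplitude m * U m], which cancels the fast field, and
   the order-one term [- gain m * U m * sU]. The double sum cancels the latter except for the means
   of the products, which add up to [D m]. *)
have dcoef m : is_derive t 1 (coef m) (e m - D m t - eps^-1 * amplitude m * U m t).
  have dV := is_derive_trig_primitive (jj m) (is_derive_add dJx (is_derive_mull (w m) dtau)).
  have dA m' := is_derive_mul ((ABCE (m, m')).2 _ _ _ _ _ dJx dtau) (dD m').
  apply: is_derive_eq (is_derive_add (is_derive_mull (- eps * gain m) dV)
    (is_derive_mull (eps ^+ 2) (is_derive_bigsum (fun m' =>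
      is_derive_mull (gain m * amplitude m') (dA m'))))) _.
  (* Distinct indices differ in frequency or in phase, so only the diagonal has a nonzero mean. *)
  have deltaE m' : (if (w m == w m') && (jj m == jj m') then 1 / 2 else 0 : R) =
      if m' == m then 1 / 2 else 0.
    have [->|mm'] := eqVneq m' m; first by rewrite !eqxx.
    case: ifP => // /andP[/eqP ww /eqP jj_eq].
    by rewrite (wj_inj ww jj_eq) eqxx in mm'.
  rewrite (_ : \sum_m' _ = eps ^- 2 * gain m * U m t * sU - eps ^- 2 * D m t +
    \sum_m' gain m * amplitude m' * (g * BB m m' t * D m' t + AA m m' t * D' m')).
    rewrite /e {1}gE -(gain_freq m) -/(wave m (x t) (tau t)) -/(U m t).
    by field.
  (* On the diagonal [gain m * amplitude m = 2] meets the mean 1/2, leaving coefficient one. *)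
  have delta_sum : \sum_m' gain m * amplitude m' *
      ((if m' == m then 1 / 2 else 0) * D m' t) = D m t.
    rewrite (bigD1 m)//= eqxx big1 ?addr0 => [|m' /negbTE ->].
      by rewrite gain_amplitude; field.
    by rewrite mul0r mulr0.
  rewrite -{1}delta_sum /sU !mulr_sumr -sumrB -big_split; apply: eq_bigr => m' _ /=.
  rewrite deltaE /U /wave /AA /BB /A /B.
  by move: (trig _ _) (trig _ _) (if _ then _ else _) (eps ^- 2) (D m' t) (D' m') => *; ring.
pose E := \sum_m e m *: bb m.
exists E; split.
  rewrite (le_trans (enorm_sum_le _))// mulr_suml ler_sum// => m _.
  rewrite enormZ mulrAC ler_wpM2r//.
  have g_le : `|g| <= MJ * (eps^-1 * S).
    by rewrite (le_trans (edot_norm_le _ _))// ler_pM.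
  rewrite (le_trans (ler_normD _ _))// mulrDl lerD//.
    rewrite normrM mulrC [leRHS](_ : _ = 1 * (eps * gain m * (MJ * (kappa * MJ)))); last by ring.
    rewrite ler_pM ?trig_le1// !normrM normrN (ger0_norm eps_ge0) (ger0_norm (gain_ge0 m)).
    rewrite ler_wpM2l ?mulr_ge0// (le_trans (edot_norm_le _ _))// ler_pM//.
    exact: drift_le.
  (* Of the two factors [eps] before the sum, one absorbs the [eps^-1] in [g] or in [D']; the other
     remains in the bound. *)
  have eg_le : `|eps * g| <= MJ * S.
    rewrite normrM ger0_norm// (le_trans (ler_wpM2l eps_ge0 g_le))//.
    by rewrite mulrCA mulVKf.
  have eD_le m' : `|eps * D' m'| <= LJ * S * enorm (bb m').
    rewrite normrM ger0_norm// (le_trans (ler_wpM2l eps_ge0 (edot_norm_le _ _)))//.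
    rewrite mulrA ler_wpM2r//.
    rewrite (le_trans (ler_wpM2l eps_ge0 (hessJ (x t) x')))// mulrCA ler_wpM2l//.
    by rewrite (le_trans (ler_wpM2l eps_ge0 x'_le))// mulVKf.
  rewrite [X in `|X|](_ : _ = eps * \sum_m' gain m * amplitude m' *
    (eps * g * BB m m' t * D m' t + AA m m' t * (eps * D' m'))); last first.
    rewrite expr2 -mulrA; congr (_ * _); rewrite mulr_sumr.
    by apply: eq_bigr => m' _; ring.
  rewrite normrM ger0_norm// mulrC ler_wpM2r// (le_trans (ler_norm_sum _ _ _))//.
  rewrite ler_sum// => m' _; rewrite normrM ger0_norm ?mulr_ge0//.
  rewrite ler_wpM2l ?mulr_ge0// (le_trans (ler_normD _ _))// lerD//.
    rewrite normrM ler_pM//; last exact: slope_le.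
    by rewrite normrM ler_pM//; exact: B_le.
  by rewrite normrM ler_pM//; exact: A_le.
apply/is_derive_rowP => k.
rewrite (_ : (fun _ => _) = fun s => x s 0 k + \sum_m bb m 0 k * coef m s); last first.
  apply/funext => s; rewrite mxE summxE; congr (_ + _).
  by apply: eq_bigr => m _; rewrite mxE mulrC.
have dxk : is_derive t 1 (fun s => x s 0 k) (x' 0 k) by move/is_derive_rowP: dx.
apply: is_derive_eq (is_derive_add dxk
  (is_derive_bigsum (fun m => is_derive_mull (bb m 0 k) (dcoef m)))) _.
rewrite !mxE !summxE -!addrA; congr (_ + _).
rewrite mulr_sumr -sumrN -!big_split; apply: eq_bigr => m _ /=.
by rewrite !mxE /D /U; ring.
Qed.

(** Descent holds exactly for the averaged field at [x]. Passing to [z] costs three errors of order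
    [eps]: the change of gradient against the averaged field, the remainder [e], and the change of
    the squared gradient norm. They are the three summands of [C1]. *)
Lemma descent_along_transform : exists C0 C1, 0 <= C0 /\ 0 <= C1 /\
  forall (eps : R) x tau, 0 < eps -> eps <= 1 -> es_trajectory eps x tau ->
  exists z : R -> 'rV[R]_n, forall t : R, 0 <= t ->
    enorm (z t - x t) <= C0 * eps /\
    exists y', is_derive t 1 (fun s => J (z s)) y' /\
      y' <= - ((gamma - kappa) * enorm (grad J (z t)) ^+ 2) + C1 * eps.
Proof.
have [C0 [C [C0_ge0 [C_ge0 H]]]] := near_identity_transform.
pose S := kappa * MJ + \sum_m MJ * enorm (bb m) * enorm (bb m).
exists C0, (LJ * C0 * S + MJ * C + (gamma - kappa) * (LJ * C0 * (MJ + MJ))).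
have gk : 0 <= gamma - kappa by rewrite subr_ge0 ltW.
have S_ge0 : 0 <= S by nonneg.
split=> //; split; first by nonneg.
move=> eps x tau eps_gt0 eps_le1 /(H eps x tau eps_gt0 eps_le1)[z zE].
exists z => t t0; have [zx [e [e_le dz]]] := zE t t0; split=> //.
eexists; split; first exact: is_derive_row_comp (dJ _) dz.
pose P := averaged_field (x t).
have gradL : enorm (grad J (z t) - grad J (x t)) <= LJ * C0 * eps.
  by rewrite (le_trans (grad_lipschitz ddJ hessJ _ _))// -mulrA ler_wpM2l.
have P_le : enorm P <= S.
  rewrite (le_trans (enormD_le _ _))// lerD ?drift_le// enormN (le_trans (enorm_sum_le _))//.
  by rewrite ler_sum// => m _; rewrite enormZ ler_wpM2r ?slope_le.
(* Excitation in the direction of the gradient gives [gamma], and the drift loses at most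
   [kappa]. *)
have main : edot (grad J (x t)) P <= - ((gamma - kappa) * enorm (grad J (x t)) ^+ 2).
  rewrite edotBr edot_sumr.
  have -> : \sum_m edot (grad J (x t)) (slope m (x t) *: bb m) =
            \sum_m edot (bb m) (grad J (x t)) ^+ 2.
    by apply: eq_bigr => m _; rewrite edotZr (edotC (bb m)) expr2.
  have ex := excitation (grad J (x t)).
  have : edot (grad J (x t)) (b0 (x t)) <= kappa * enorm (grad J (x t)) ^+ 2.
    rewrite (le_trans (edot_le_enorm _ _))//.
    rewrite [leRHS](_ : _ = enorm (grad J (x t)) * (kappa * enorm (grad J (x t)))).
      by rewrite ler_wpM2l.
    by ring.
  by rewrite mulrBl; lra.
have T1 : edot (grad J (z t) - grad J (x t)) P <= LJ * C0 * eps * S.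
  by rewrite (le_trans (edot_le_enorm _ _))// ler_pM ?enorm_ge0.
have T2 : edot (grad J (z t)) e <= MJ * (C * eps).
  by rewrite (le_trans (edot_le_enorm _ _))// ler_pM ?enorm_ge0.
have T3 : enorm (grad J (z t)) ^+ 2 - enorm (grad J (x t)) ^+ 2 <=
    LJ * C0 * eps * (MJ + MJ).
  rewrite subr_sqr (@le_trans _ _ (LJ * C0 * eps *
    (enorm (grad J (z t)) + enorm (grad J (x t)))))//.
    rewrite ler_wpM2r ?addr_ge0 ?enorm_ge0//.
    by rewrite (le_trans (ler_norm _))// (le_trans (enorm_dist_le _ _)).
  by rewrite ler_wpM2l ?mulr_ge0 ?lerD// ltW.
have := ler_wpM2l gk T3.
have -> : edot (grad J (z t)) (P + e) = edot (grad J (x t)) P +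
  edot (grad J (z t) - grad J (x t)) P + edot (grad J (z t)) e.
  by rewrite edotDr edotBl; ring.
move: main T1 T2; set q := edot _ P; set q1 := edot _ P; set q2 := edot _ e.
by lra.
Qed.

End Averaging.

(** * Comparison functions *)

Section ComparisonFunctions.
Context {R : realType}.
Implicit Types (f g mu sigma : R -> R).

Local Notation nonneg_set := [set s : R | 0 <= s].

Lemma within_nonneg_continuousP f : {within nonneg_set, continuous f} <->
  forall x e, 0 <= x -> 0 < e ->
    exists2 d, 0 < d & forall y, 0 <= y -> `|x - y| < d -> `|f x - f y| < e.
Proof.
split=> [/subspace_continuousP fc x e x0 e0|H].
  have /cvgrPdist_lt/(_ _ e0) := fc x x0.
  move=> /nbhs_ballP[d /= d0 xd]; exists d => // y y0 xy.
  exact: xd.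
apply/subspace_continuousP => x x0.
apply/cvgrPdist_lt => e e0; have [d d0 xd] := H x e x0 e0.
by apply/nbhs_ballP; exists d => //= y xy y0; exact: xd.
Qed.

Lemma class_K_lt f x y : class_K f -> 0 <= x -> x < y -> f x < f y.
Proof. by case=> _ [_]; apply. Qed.

Lemma class_K_le f x y : class_K f -> 0 <= x -> x <= y -> f x <= f y.
Proof.
move=> Kf x0; rewrite le_eqVlt => /predU1P[->//|xy].
by rewrite ltW// class_K_lt.
Qed.

Lemma class_K_ge0 f x : class_K f -> 0 <= x -> 0 <= f x.
Proof. by move=> Kf x0; rewrite -Kf.1 class_K_le. Qed.

Lemma class_K_gt0 f x : class_K f -> 0 < x -> 0 < f x.
Proof. by move=> Kf x0; rewrite -Kf.1 class_K_lt. Qed.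

Lemma class_K_comp f g : class_K f -> class_K g -> class_K (f \o g).
Proof.
move=> Kf Kg; split=> /=; first by rewrite Kg.1 Kf.1.
split=> [|s1 s2 s10 s12]; last first.
  by apply: class_K_lt => //; [exact: class_K_ge0|exact: class_K_lt].
apply/within_nonneg_continuousP => x e x0 e0.
have [d1 d10 H1] := (within_nonneg_continuousP f).1 Kf.2.1 _ _ (class_K_ge0 Kg x0) e0.
have [d2 d20 H2] := (within_nonneg_continuousP g).1 Kg.2.1 _ _ x0 d10.
by exists d2 => // y y0 xy /=; apply: H1; [exact: class_K_ge0|exact: H2].
Qed.

Lemma class_K_scale k : 0 < k -> class_K (fun s : R => k * s).
Proof.
move=> k0; split; first by rewrite mulr0.
split=> [|s1 s2 _ s12]; last by rewrite ltr_pM2l.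
by apply: continuous_subspaceT => s; apply: cvgM; [exact: cvg_cst|exact: cvg_id].
Qed.

Lemma class_K_sqr : class_K (fun s : R => s ^+ 2).
Proof.
split; first by rewrite expr0n.
split=> [|s1 s2 s10 s12].
  by apply: continuous_subspaceT => s; exact: exprn_continuous.
by rewrite ltr_pXn2r ?nnegrE// (le_trans s10)// ltW.
Qed.

Lemma class_K_add f g : class_K f -> (g 0 = 0) -> {within nonneg_set, continuous g} ->
  (forall x y, 0 <= x -> x <= y -> g x <= g y) -> class_K (fun s => f s + g s).
Proof.
move=> Kf g0 cg le_g; split; first by rewrite Kf.1 g0 addr0.
split=> [|s1 s2 s10 s12]; last by rewrite ltr_leD ?class_K_lt// le_g// ltW.
move=> s; apply: (@continuousD R R (subspace nonneg_set)); first exact: Kf.2.1.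
exact: cg.
Qed.

(* [h] is a bijection of the half-line, and a right inverse of it is continuous
   because it is monotone. *)
Lemma class_K_inverse (h : R -> R) : class_K h ->
  (forall M : R, exists2 s, 0 <= s & M <= h s) ->
  exists2 g, class_K g & forall y, 0 <= y -> h (g y) = y.
Proof.
move=> Kh h_unbounded.
have /choice[g gE] (y : R) : exists s, 0 <= y -> 0 <= s /\ h s = y.
  have [y0|] := leP 0 y; last by exists 0.
  have [s s0 ys] := h_unbounded y.
  have hs : {within `[0, s], continuous h}.
    by apply: continuous_subspaceW Kh.2.1 => u /=; rewrite in_itv/= => /andP[].
  have [|u] := @IVT R h 0 s y s0 hs.
    by rewrite Kh.1 min_l ?max_r ?y0// class_K_ge0.
  by rewrite in_itv/= => /andP[u0 _] hu; exists u.
have g_ge0 y : 0 <= y -> 0 <= g y by move=> /gE[].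
have hg y : 0 <= y -> h (g y) = y by move=> /gE[].
have lt_g y s : 0 <= y -> 0 <= s -> y < h s -> g y < s.
  move=> y0 s0; rewrite -{1}(hg y y0); apply: contraTT; rewrite -!leNgt => sg.
  exact: class_K_le.
have g_lt y s : 0 <= y -> 0 <= s -> h s < y -> s < g y.
  move=> y0 s0; rewrite -{1}(hg y y0); apply: contraTT; rewrite -!leNgt => sg.
  by rewrite class_K_le// g_ge0.
exists g => //; split.
  apply/eqP; rewrite eq_le g_ge0// andbT leNgt; apply/negP => /(class_K_gt0 Kh).
  by rewrite hg// ltxx.
split=> [|y1 y2 y10 y12]; last first.
  by have y20 := le_trans y10 (ltW y12); rewrite g_lt ?g_ge0// hg.
apply/within_nonneg_continuousP => y e y0 e0.
have up : y < h (g y + e).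
  by rewrite -{1}(hg y y0) class_K_lt ?g_ge0// ltrDl.
have g_up z : 0 <= z -> z < h (g y + e) -> g z < g y + e.
  by move=> z0; apply: lt_g => //; rewrite addr_ge0 ?g_ge0// ltW.
(* If [g y < e], the lower estimate follows from [g z >= 0]; otherwise [g y - e] is in the domain of
   [h] and can be used as a barrier. *)
have [ey|ey] := ltP (g y) e.
  exists (h (g y + e) - y) => [|z z0]; first by rewrite subr_gt0.
  rewrite !ltr_norml => /andP[yz _]; have gz := g_ge0 z z0.
  have := g_up z z0; have : z < h (g y + e) by lra.
  by move=> -> /(_ isT) ?; apply/andP; split; lra.
have dn : h (g y - e) < y.
  by rewrite -{2}(hg y y0) class_K_lt ?subr_ge0// gtrDl oppr_lt0.
exists (Num.min (h (g y + e) - y) (y - h (g y - e))) => [|z z0].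
  by rewrite lt_min !subr_gt0 up.
rewrite lt_min !ltr_norml => /andP[/andP[yz1 yz2] /andP[yz3 yz4]].
have gz1 : g z < g y + e by apply: g_up => //; lra.
have gz2 : g y - e < g z by apply: g_lt; rewrite ?subr_ge0//; lra.
by apply/andP; split; lra.
Qed.

(* [beta s t] is the solution [r] of [mu r + t * sigma r = c * s]. *)
Lemma class_KL_of_gain mu sigma c : 0 < c ->
  class_K mu -> (forall M : R, exists2 s, 0 <= s & M <= mu s) -> class_K sigma ->
  exists2 beta, class_KL beta & forall r s t, 0 <= r -> 0 <= s -> 0 <= t ->
    mu r + t * sigma r <= c * s -> r <= beta s t.
Proof.
move=> c0 Kmu mu_unbounded Ksigma.
(* Truncating [t] at [0] makes [h t] class K for every real [t], so that inverses can be chosen for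
   all [t] at once. *)
pose h t r := mu r + Num.max 0 t * sigma r.
have max_ge0 (t : R) : 0 <= Num.max 0 t by rewrite le_max lexx.
have Kh t : class_K (h t).
  apply: class_K_add => //; first by rewrite Ksigma.1 mulr0.
    move=> s; apply: (@continuousM R (subspace nonneg_set) (fun=> Num.max 0 t));
      last exact: Ksigma.2.1.
    exact: cst_continuous.
  by move=> x y x0 xy; rewrite ler_wpM2l// class_K_le.
have h_unbounded t M : exists2 s, 0 <= s & M <= h t s.
  have [s s0 Ms] := mu_unbounded M; exists s => //.
  by rewrite (le_trans Ms)// lerDl mulr_ge0// class_K_ge0.
have /choice[g gE] (t : R) : exists g, class_K g /\ forall y, 0 <= y -> h t (g y) = y.
  by have [g] := class_K_inverse (Kh t) (h_unbounded t); exists g.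
have le_g t r y : 0 <= r -> 0 <= y -> h t r <= y -> r <= g t y.
  move=> r0 y0; rewrite -{1}((gE t).2 y y0); apply: contraTT; rewrite -!ltNge => gr.
  by apply: class_K_lt => //; apply: class_K_ge0 => //; exact: (gE t).1.
have g_ge0 t y : 0 <= y -> 0 <= g t y by move=> y0; apply: class_K_ge0 => //; exact: (gE t).1.
exists (fun s t => g t (c * s)); last first.
  move=> r s t r0 s0 t0 H; apply: le_g => //; first by rewrite mulr_ge0// ltW.
  by rewrite /h max_r.
split=> [t t0|s s0]; first exact: class_K_comp (gE t).1 (class_K_scale c0).
have cs0 : 0 <= c * s by rewrite mulr_ge0// ltW.
split=> [t1 t2 t10 t12|].
  apply: le_g; rewrite ?g_ge0// -[leRHS]((gE t2).2 _ cs0) /h lerD2l.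
  rewrite ler_wpM2r//; first by apply: class_K_ge0 => //; exact: g_ge0.
  by rewrite !max_r// (le_trans t10).
apply/cvgrPdist_le => e e0.
have se : 0 < sigma e by exact: class_K_gt0.
(* Past this time a root above [e] would make [t * sigma] alone exceed [c * s]. *)
exists (Num.max 0 (c * s / sigma e)); split; first exact: num_real.
move=> t; rewrite gt_max => /andP[t0 /ltW]; rewrite ler_pdivrMr// => cst.
rewrite sub0r normrN ger0_norm ?g_ge0// leNgt; apply/negP => eg.
have := (gE t).2 _ cs0; rewrite /h max_r ?ltW// => H.
have : sigma e < sigma (g t (c * s)) by apply: class_K_lt => //; exact: ltW.
have : 0 < mu (g t (c * s)) by apply: class_K_gt0 => //; exact: lt_trans eg.
move=> mu0; rewrite -(ltr_pM2l t0) => H2.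
by move: cst; rewrite -{1}H leNgt => /negP; apply; lra.
Qed.

End ComparisonFunctions.

(** The infimum over [x] of [J x - J xstar + Num.max 0 (s - enorm (x - xstar))] is a nondecreasing
    1-Lipschitz minorant, which gives continuity at once. It is positive for [s > 0] by compactness
    and unbounded by coercivity; the factor [s / (1 + s)] makes it strictly increasing. *)
Lemma coercive_lower_bound (R : realType) n (J : 'rV[R]_n -> R) (xstar : 'rV[R]_n) :
  continuous J -> (forall x, x != xstar -> J xstar < J x) ->
  (forall M : R, exists R0 : R, forall x, enorm x > R0 -> J x > M) ->
  exists mu : R -> R, [/\ class_K mu,
    (forall M : R, exists2 s, 0 <= s & M <= mu s) &
    forall x, mu (enorm (x - xstar)) <= J x - J xstar].
Proof.
move=> cJ J_min J_coercive.
have J_ge x : 0 <= J x - J xstar.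
  by rewrite subr_ge0; have [->//|/J_min/ltW] := eqVneq x xstar.
have J_pos d : 0 < d -> exists2 eta, 0 < eta &
    forall x, d <= enorm (x - xstar) -> eta <= J x - J xstar.
  move=> d0; have [R0 JR0] := J_coercive (J xstar + 1).
  (* On this compact set the cost attains a minimum above [J xstar]; beyond [R0] the excess is at
     least 1, whence the minimum with 1 below. *)
  pose K := [set x : 'rV[R]_n | enorm x <= R0 /\ d <= enorm (x - xstar)].
  have [K0|] := eqVneq K set0.
    exists 1 => // x xd; rewrite lerBrDl ltW// JR0// ltNge; apply/negP => xR0.
    by have : K x by []; rewrite K0.
  move=> /set0P K_neq0.
  have cK : compact K.
    have box : compact [set v : 'rV[R]_n | forall i, `[- R0, R0]%classic (v ord0 i)].
      by apply: (@rV_compact R n (fun=> `[- R0, R0]%classic)) => i; exact: segment_compact.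
    apply: subclosed_compact box _.
      apply: closedI.
        apply: (@closed_comp _ _ (@enorm R n) [set y : R | y <= R0]); last exact: closed_le.
        by move=> x _; exact: enorm_continuous.
      apply: (@closed_comp _ _ (fun x : 'rV[R]_n => enorm (x - xstar)) [set y : R | d <= y]).
        by move=> x _; exact: enorm_shift_continuous.
      exact: closed_ge.
    move=> x [xR0 _] i /=; rewrite in_itv/= -ler_norml.
    by rewrite (le_trans _ xR0)// coord_le_enorm.
  have cJK : {within K, continuous J} by exact: continuous_subspaceT.
  have [z zK zmin] := EVT_min_rV K_neq0 cK cJK.
  have zd : d <= enorm (z - xstar) by move: zK; rewrite inE => -[].
  exists (Num.min 1 (J z - J xstar)).
    rewrite lt_min ltr01 subr_gt0 J_min//; apply: contraTneq zd => ->.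
    by rewrite subrr enorm0 -ltNge.
  move=> x xd; rewrite ge_min; have [xR0|xR0] := leP (enorm x) R0.
    by rewrite lerB ?orbT// zmin// inE.
  by rewrite lerBrDl ltW// JR0.
pose F s x := J x - J xstar + Num.max 0 (s - enorm (x - xstar)).
pose m s := inf (range (F s)).
have F_ge0 s x : 0 <= F s x by rewrite addr_ge0// le_max lexx.
have m_le s x : m s <= F s x.
  by apply: ge_inf; [exists 0 => _ [y _ <-]|exists x].
have le_m s c : (forall x, c <= F s x) -> c <= m s.
  by move=> cF; apply: lb_le_inf; [exists (F s xstar), xstar|move=> _ [y _ <-]].
have m_ge0 s : 0 <= m s by exact: le_m.
have m_mono s1 s2 : s1 <= s2 -> m s1 <= m s2.
  move=> s12; apply: le_m => x; rewrite (le_trans (m_le s1 x))// lerD2l.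
  by rewrite ge_max !le_max lexx/= lerD2r s12 orbT.
have m_lip s1 s2 : s1 <= s2 -> m s2 - m s1 <= s2 - s1.
  move=> s12; rewrite lerBlDr -lerBlDl; apply: le_m => x.
  rewrite lerBlDl (le_trans (m_le s2 x))// /F addrCA lerD2l.
  set q := enorm _; have : s1 - q <= Num.max 0 (s1 - q) by rewrite le_max lexx orbT.
  have : 0 <= Num.max 0 (s1 - q) by rewrite le_max lexx.
  by rewrite ge_max => *; apply/andP; split; lra.
have m_cont : continuous m.
  move=> s; apply/cvgrPdist_le => e e0; apply/nbhs_ballP; exists e => //= s'.
  rewrite /ball/= => /ltW ss'; apply: le_trans ss'; have [ss'|s's] := leP s s'.
    rewrite distrC (distrC s) !ger0_norm ?subr_ge0 ?m_mono//; exact: m_lip.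
  by rewrite !ger0_norm ?subr_ge0 ?m_mono ?m_lip// ltW.
have m_gt0 s : 0 < s -> 0 < m s.
  move=> s0; have s20 : 0 < s / 2 by rewrite divr_gt0.
  have [eta eta0 Jeta] := J_pos _ s20.
  apply: (@lt_le_trans _ _ (Num.min eta (s / 2))); first by rewrite lt_min eta0.
  apply: le_m => x; rewrite ge_min; have [xs|xs] := leP (s / 2) (enorm (x - xstar)).
    by rewrite (le_trans (Jeta x xs))// lerDl le_max lexx.
  apply/orP; right; apply: (@le_trans _ _ (s - enorm (x - xstar))); first by lra.
  by rewrite -[leLHS]add0r lerD// le_max lexx orbT.
have m_unbounded M : exists s0, forall s, s0 <= s -> M <= m s.
  have [R0 JR0] := J_coercive (J xstar + M).
  (* For such [s], points within [R0] pay at least [M] through the distance term, and points beyond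
     [R0] through the cost. *)
  exists (R0 + enorm xstar + M) => s s0; apply: le_m => x.
  have [xR0|xR0] := leP (enorm x) R0.
    have := enormD_le x (- xstar); rewrite enormN => xq.
    apply: (@le_trans _ _ (s - enorm (x - xstar))); first by lra.
    by rewrite -[leLHS]add0r lerD// le_max lexx orbT.
  rewrite (@le_trans _ _ (J x - J xstar))//; first by rewrite lerBrDl ltW// JR0.
  by rewrite lerDl le_max lexx.
have m0 : m 0 = 0.
  apply/eqP; rewrite eq_le m_ge0 andbT (le_trans (m_le 0 xstar))//.
  by rewrite /F !subrr enorm0 subrr maxxx addr0.
have den_gt0 (s : R) : 0 <= s -> 0 < 1 + s by move=> s0; rewrite ltr_wpDr.
have frac_lt (s1 s2 : R) : 0 <= s1 -> s1 < s2 -> s1 / (1 + s1) < s2 / (1 + s2).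
  move=> s10 s12; have s20 := le_trans s10 (ltW s12).
  by rewrite ltr_pdivrMr ?den_gt0// mulrAC ltr_pdivlMr ?den_gt0//; lra.
exists (fun s => m s * (s / (1 + s))); split.
- split; first by rewrite mul0r mulr0.
  split=> [|s1 s2 s10 s12]; last first.
    have s20 := le_lt_trans s10 s12.
    apply: (@le_lt_trans _ _ (m s2 * (s1 / (1 + s1)))).
      by rewrite ler_wpM2r ?(divr_ge0 s10 (ltW (den_gt0 _ s10)))// m_mono// ltW.
    by rewrite ltr_pM2l ?m_gt0// frac_lt.
  apply: continuous_in_subspaceT => s; rewrite inE/= => s0.
  apply: (@continuousM R R); first exact: m_cont.
  apply: (@continuousM R R); first exact: cvg_id.
  apply: continuousV; first by rewrite gt_eqF// den_gt0.
  by apply: continuousD; [exact: cst_continuous|exact: cvg_id].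
(* The target is doubled because [s / (1 + s)] is only known to be at least 1/2 once [s >= 1]. *)
- move=> M; have [s0 Ms0] := m_unbounded (2 * Num.max 0 M).
  have [s [s1 s0s]] : exists s, 1 <= s /\ s0 <= s.
    by exists (Num.max 1 s0); rewrite !le_max !lexx orbT.
  have s_ge0 : 0 <= s by rewrite (le_trans _ s1).
  exists s => //.
  have Ms : 2 * Num.max 0 M <= m s by exact: Ms0.
  have half : 1 / 2 <= s / (1 + s).
    by rewrite ler_pdivlMr ?den_gt0//; lra.
  have M0 : M <= Num.max 0 M by rewrite le_max lexx orbT.
  have : m s * (1 / 2) <= m s * (s / (1 + s)) by rewrite ler_wpM2l.
  by lra.
- move=> x; set q := enorm _; have q0 : 0 <= q by exact: enorm_ge0.
  apply: (@le_trans _ _ (m q)).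
    by rewrite ler_piMr// ler_pdivrMr ?den_gt0// mul1r lerDr.
  by rewrite (le_trans (m_le q x))// /F subrr maxxx addr0.
Qed.

(** If [y] is above the level at time [t], it was at least [y t] at all earlier times, so it
    decreased at rate at least [rho (y t)] on all of [[0, t]]. *)
Lemma decay_above_level (R : realType) (y dy rho : R -> R) (eta : R) :
  (forall t : R, 0 <= t -> is_derive t 1 y (dy t)) ->
  (forall u v, eta <= u -> u <= v -> rho u <= rho v) -> 0 < rho eta ->
  (forall t, 0 <= t -> eta <= y t -> dy t <= - rho (y t)) ->
  forall t, 0 <= t -> eta <= y t -> y t + t * rho (y t) <= y 0.
Proof.
move=> yE rho_mono rho_gt0 dy_le t t0 yt.
(* Were [y s < y t], the maximum over [[s, t]] would be reached at some [u > s] above the level,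
   where the derivative is negative; a maximum from the left forbids this. *)
have y_ge s : 0 <= s <= t -> y t <= y s.
  move=> /andP[s0 st]; rewrite leNgt; apply/negP => ys.
  have cy : {within `[s, t], continuous y}.
    apply: continuous_in_subspaceT => u; rewrite inE/= in_itv/= => /andP[su _].
    by apply: is_derive_continuous; apply: yE; exact: le_trans su.
  have [u] := EVT_max st cy; rewrite in_itv/= => /andP[su ut] ymax.
  have ytu : y t <= y u by apply: ymax; rewrite in_itv/= st lexx.
  have {}su : s < u.
    by rewrite lt_neqAle su andbT; apply: contraTneq ys => ->; rewrite -leNgt.
  have u0 := le_trans s0 (ltW su).
  have : dy u < 0.
    have yu : eta <= y u by exact: le_trans ytu.
    rewrite (le_lt_trans (dy_le u u0 yu))// oppr_lt0 (lt_le_trans rho_gt0)//.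
    exact: rho_mono.
  rewrite ltNge => /negP; apply; apply: derive_ge0_at_left_max su (yE u u0) _.
  by move=> v /andP[sv vu]; apply: ymax; rewrite in_itv/= sv (le_trans vu).
have := @le_of_is_derive R y dy 0 t (- rho (y t)) t0.
have H s : 0 <= s <= t -> is_derive s 1 y (dy s) by move=> /andP[s0 _]; exact: yE.
move=> /(_ H) H'; suff : y t - y 0 <= - rho (y t) * (t - 0) by lra.
apply: H' => s st; have /andP[s0 _] := st; have yst := y_ge s st.
rewrite (le_trans (dy_le s s0 _)) ?(le_trans yt)// lerN2.
exact: rho_mono.
Qed.

(** * The extremum seeking system *)

Section ExtremumSeeking.
Context {R : realType} {n r : nat}.
Context (b : 'I_r -> 'I_2 -> 'rV[R]_n) (omega : 'I_r -> rat).
Context (b0 : 'rV[R]_n -> 'rV[R]_n) (J : 'rV[R]_n -> R) (xstar : 'rV[R]_n).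
Context (kappa3 L0 MJ : R).
Context (dJ : forall x, differentiable J x) (MJ_ge0 : 0 <= MJ)
  (gradJ : forall x, enorm (grad J x) <= MJ)
  (kappa3_ge0 : 0 <= kappa3)
  (b0J : forall x, enorm (b0 x) <= kappa3 * enorm (grad J x))
  (L0_ge0 : 0 <= L0)
  (b0_lip : forall x1 x2, enorm (b0 x1 - b0 x2) <= L0 * enorm (x1 - x2)).

Definition es_frequency (m : 'I_r * 'I_2) : R := ratr (omega m.1).
Definition es_amplitude (m : 'I_r * 'I_2) : R := Num.sqrt (2 * es_frequency m).
Local Notation field := (es_field b0 J b omega xstar).

#[local] Hint Extern 0 (is_true (0 <= enorm _)) => exact: enorm_ge0 : core.
#[local] Hint Extern 0 (is_true (0 <= es_amplitude _)) => exact: sqrtr_ge0 : core.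

Lemma es_fieldE eps x tau : field eps x tau = b0 (x + xstar) + eps^-1 *:
  \sum_m (es_amplitude m * trig m.2 (J (x + xstar) + es_frequency m * tau)) *: b m.1 m.2.
Proof.
congr (_ + _ *: _).
rewrite -(pair_big xpredT xpredT (fun i j => (es_amplitude (i, j) *
  trig j (J (x + xstar) + es_frequency (i, j) * tau)) *: b i j))/=.
apply: eq_bigr => i _; rewrite big_ord_recl big_ord1.
by rewrite (_ : lift ord0 ord0 = 1) //; exact: val_inj.
Qed.

Lemma cost_lipschitz x y : `|J x - J y| <= MJ * enorm (x - y).
Proof.
rewrite ler_norml lerNl opprB {1}enormB.
by rewrite !(lipschitz_of_grad_le dJ gradJ).
Qed.

Lemma trig_lipschitz j (u v : R) : `|trig j u - trig j v| <= `|u - v|.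
Proof.
have lip (s t : R) : s <= t -> `|trig j t - trig j s| <= t - s.
  move=> st; have H := @increment_norm_le R (trig j)
    (fun u => if j == 0 then - sin u else cos u) id (fun=> 1) s t st.
  apply: H => c _; first by rewrite /trig; case: (j == 0);
    [exact: is_derive_cos|exact: is_derive_sin].
  have [ss cc] := (trig_le1 1 c, trig_le1 0 c).
  by case: (j == 0); rewrite ?normrN.
have [uv|/ltW uv] := leP v u; first by rewrite (ger0_norm (_ : 0 <= u - v)) ?subr_ge0 ?lip.
by rewrite distrC (distrC u) (ger0_norm (_ : 0 <= v - u)) ?subr_ge0 ?lip.
Qed.

(** Bounded gradient makes the cost, hence each wave, globally Lipschitz. The estimate is joint in
    state and time, so it also gives the continuity in time that the existence proof requires. *)
Lemma es_field_lipschitz (eps : R) : 0 < eps -> exists2 K, 0 < K &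
  forall x y tau sigma,
    enorm (field eps x tau - field eps y sigma) <= K * (enorm (x - y) + `|tau - sigma|).
Proof.
move=> eps_gt0; have ieps_ge0 : 0 <= eps^-1 by rewrite invr_ge0 ltW.
pose S := \sum_m es_amplitude m * (MJ + `|es_frequency m|) * enorm (b m.1 m.2).
have S_ge0 : 0 <= S by rewrite /S; nonneg.
exists (L0 + eps^-1 * S + 1) => [|x y tau sigma].
  by rewrite ltr_wpDl// addr_ge0// mulr_ge0.
set q := enorm (x - y) + _.
have q_ge0 : 0 <= q by rewrite addr_ge0.
have xyE : x + xstar - (y + xstar) = x - y by rewrite opprD addrACA subrr addr0.
rewrite !es_fieldE opprD addrACA -scalerBr -sumrB (le_trans (enormD_le _ _))//.
apply: (@le_trans _ _ (L0 * q + eps^-1 * S * q)); last first.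
  by rewrite -mulrDl ler_wpM2r// lerDl.
rewrite lerD//; first by rewrite (le_trans (b0_lip _ _))// xyE ler_wpM2l// lerDl.
rewrite enormZ ger0_norm// -mulrA ler_wpM2l// (le_trans (enorm_sum_le _))//.
rewrite mulr_suml ler_sum// => m _.
rewrite -scalerBl enormZ [leRHS]mulrAC ler_wpM2r//.
rewrite -mulrBr normrM (ger0_norm (_ : 0 <= es_amplitude m))// -[leRHS]mulrA.
rewrite ler_wpM2l//.
rewrite (le_trans (trig_lipschitz _ _ _))// opprD addrACA -mulrBr.
rewrite (le_trans (ler_normD _ _))// mulrDl lerD//.
  by rewrite (le_trans (cost_lipschitz _ _))// xyE ler_wpM2l// lerDl.
by rewrite normrM ler_wpM2l// lerDr.
Qed.

Lemma es_field_bounded (eps : R) : 0 < eps -> exists B, forall x tau,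
  enorm (field eps x tau) <= B.
Proof.
move=> eps_gt0; have ieps_ge0 : 0 <= eps^-1 by rewrite invr_ge0 ltW.
exists (kappa3 * MJ + eps^-1 * \sum_m es_amplitude m * enorm (b m.1 m.2)) => x tau.
rewrite es_fieldE (le_trans (enormD_le _ _))// lerD//.
  by rewrite (le_trans (b0J _))// ler_wpM2l.
rewrite enormZ ger0_norm// ler_wpM2l// (le_trans (enorm_sum_le _))//.
rewrite ler_sum// => m _; rewrite enormZ ler_wpM2r// normrM ger0_norm//.
by rewrite ler_piMr// trig_le1.
Qed.

(** The clock equation is solved explicitly, which leaves a time-dependent equation for the state
    with bounded, globally Lipschitz field. *)
Lemma es_global_solution (eps : R) x0 tau0 : 0 < eps ->
  exists x : R -> 'rV[R]_n, x 0 = x0 /\ forall t : R, 0 <= t ->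
    is_derive t 1 x (field eps (x t) (tau0 + eps ^- 2 * t)).
Proof.
move=> eps_gt0; have [K K_gt0 lipK] := es_field_lipschitz eps_gt0.
have [B fB] := es_field_bounded eps_gt0.
pose f t x := field eps x (tau0 + eps ^- 2 * t).
apply: (@global_solution R n f (K * (n%:R + 1)) B x0).
- by rewrite mulr_gt0// ltr_wpDl.
- move=> x cx t; apply/(@cvgrPdist_lt _ _ _ _ (nbhs_filter t)) => e e0.
  (* The factor [(n%:R + 1) * (eps ^- 2 + 1)] covers both the change of norm and the speed of the
     clock; the 2 shares [e] between state and time. *)
  pose q := e / (2 * K * (n%:R + 1) * (eps ^- 2 + 1)).
  have n1 : 1 <= n%:R + 1 :> R by rewrite lerDr.
  have e1 : 1 <= eps ^- 2 + 1 by rewrite lerDr invr_ge0 sqr_ge0.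
  have D_gt0 : 0 < 2 * K * (n%:R + 1) * (eps ^- 2 + 1).
    by rewrite !mulr_gt0// (lt_le_trans ltr01).
  have q_gt0 : 0 < q by rewrite divr_gt0.
  have /(@cvgrPdist_lt _ _ _ _ (nbhs_filter t))/(_ _ q_gt0) xq := cx t.
  near=> s.
  have xts : `|x t - x s| < q by near: s; exact: xq.
  have ts : `|t - s| < q.
    near: s; apply: (@cvgr_dist_lt _ _ _ _ (nbhs_filter t)) => //; exact: cvg_id.
  rewrite (le_lt_trans (mx_norm_le_enorm _))// (le_lt_trans (lipK _ _ _ _))//.
  rewrite opprD addrACA subrr add0r -mulrBr normrM ger0_norm ?invr_ge0 ?sqr_ge0//.
  have en : enorm (x t - x s) <= (n%:R + 1) * (eps ^- 2 + 1) * `|x t - x s|.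
    rewrite (le_trans (enorm_le_mx_norm _))// ler_wpM2r//.
    by rewrite (@le_trans _ _ (n%:R + 1))// ?lerDl// ler_peMr// (le_trans _ n1).
  have ee : eps ^- 2 * `|t - s| <= (n%:R + 1) * (eps ^- 2 + 1) * `|t - s|.
    rewrite ler_wpM2r// (@le_trans _ _ (eps ^- 2 + 1))// ?lerDl// ler_peMl//.
    by rewrite (le_trans _ e1).
  have k_gt0 : 0 < (n%:R + 1) * (eps ^- 2 + 1) :> R.
    by rewrite mulr_gt0// (lt_le_trans ltr01).
  have -> : e = K * ((n%:R + 1) * (eps ^- 2 + 1) * q + (n%:R + 1) * (eps ^- 2 + 1) * q).
    rewrite -[LHS](divfK (lt0r_neq0 D_gt0)) -/q; ring.
  rewrite ltr_pM2l// (le_lt_trans (lerD en ee))//.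
  by rewrite ltrD// ltr_pM2l.
- move=> t x y; rewrite (le_trans (mx_norm_le_enorm _))// (le_trans (lipK _ _ _ _))//.
  rewrite subrr normr0 addr0 -mulrA ler_wpM2l ?(ltW K_gt0)//.
  by rewrite (le_trans (enorm_le_mx_norm _))// ler_wpM2r// lerDl.
- by move=> t x; apply: le_trans (mx_norm_le_enorm _) (fB _ _).
Unshelve. all: by end_near. Qed.

(** The clock has constant slope, so it is determined first; both states then solve the same
    time-dependent equation on [[0, t]]. *)
Lemma es_solution_unique (eps : R) x0 tau0 ts xs taus (x : R -> 'rV[R]_n) : 0 < eps ->
  es_solution b0 J b omega xstar eps x0 tau0 ts xs taus ->
  x 0 = x0 ->
  (forall t : R, 0 <= t -> is_derive t 1 x (field eps (x t) (tau0 + eps ^- 2 * t))) ->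
  forall t, 0 <= t -> (t%:E < ts)%E -> x t = xs t /\ tau0 + eps ^- 2 * t = taus t.
Proof.
move=> eps_gt0 [_ [xs0 [taus0 [cxs [ctaus dxs]]]]] x_0 dx.
have lt_ts (s t : R) : s <= t -> (t%:E < ts)%E -> (s%:E < ts)%E.
  by move=> st; apply: le_lt_trans; rewrite lee_fin.
have sub_ts (t : R) : (t%:E < ts)%E ->
    `[0, t]%classic `<=` [set t | 0 <= t /\ (t%:E < ts)%E].
  by move=> tts s /=; rewrite in_itv/= => /andP[s0 st]; split=> //; exact: lt_ts tts.
have tausE (t : R) : 0 <= t -> (t%:E < ts)%E -> tau0 + eps ^- 2 * t = taus t.
  move=> t0 tts.
  have [||s _] := @MVT_segment R taus (fun=> eps ^- 2) 0 t t0.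
  - move=> s; rewrite in_itv/= => /andP[s0 st].
    exact: (dxs s s0 (lt_ts _ _ (ltW st) tts)).2.
  - exact: continuous_subspaceW (sub_ts t tts) ctaus.
  by rewrite taus0 subr0 => /eqP; rewrite subr_eq addrC => /eqP.
move=> t t0 tts; split; last exact: tausE.
have [K _ lipK] := es_field_lipschitz eps_gt0.
apply: (@ode_unique R n (fun t x => field eps x (tau0 + eps ^- 2 * t)) K) => //.
- by move=> s u v; have := lipK u v (tau0 + eps ^- 2 * s) (tau0 + eps ^- 2 * s);
    rewrite subrr normr0 addr0.
- apply: continuous_in_subspaceT => s; rewrite inE/= in_itv/= => /andP[s0 _].
  apply: differentiable_continuous; apply/derivable1_diffP.
  by case: (dx s s0).
- exact: continuous_subspaceW (sub_ts t tts) cxs.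
- by move=> s /andP[s0 _]; apply: dx; exact: ltW.
- move=> s /andP[s0 st]; have sts := lt_ts _ _ (ltW st) tts.
  by rewrite tausE ?(ltW s0)//; exact: (dxs s s0 sts).1.
- by rewrite x_0 xs0.
Qed.

End ExtremumSeeking.

(** * Practical stability from the averaged descent *)

Unset Implicit Arguments.

Theorem theorem3 (R : realType) (n r : nat)
  (b : 'I_r -> 'I_2 -> 'rV[R]_n) (omega : 'I_r -> rat)
  (b0 : 'rV[R]_n -> 'rV[R]_n) (J : 'rV[R]_n -> R) (xstar : 'rV[R]_n)
  (gamma kappa3 LJ L0 MJ : R) (alphaJ : R -> R) :
  (1 <= n)%N -> (0 < r)%N -> (n <= 2 * r)%N ->
  injective omega -> (forall i, 0 < omega i) ->
  (* J^* = inf J > -oo is attained at xstar *)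
  (forall x, J xstar <= J x) ->
  (* Excitation Assumption *)
  0 < gamma ->
  (forall v : 'rV[R]_n,
     \sum_(i < r) \sum_(j < 2) (edot (b i j) v) ^+ 2 >= gamma * (enorm v) ^+ 2) ->
  (* Regularity Assumption *)
  (forall x, x != xstar -> J x > J xstar) ->
  (forall x, grad J x = 0 <-> x = xstar) ->
  0 < LJ -> (forall x, opnorm_le (hess J x) LJ) ->
  0 < kappa3 -> (forall x, enorm (b0 x) <= kappa3 * enorm (grad J x)) ->
  0 < L0 -> (forall x1 x2, enorm (b0 x1 - b0 x2) <= L0 * enorm (x1 - x2)) ->
  (* additional hypotheses of the theorem *)
  gamma > kappa3 ->
  C2 J ->
  (forall M : R, exists R0 : R, forall x, enorm x > R0 -> J x > M) ->
  class_K alphaJ -> 0 < MJ ->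
  (forall x, alphaJ (enorm (x - xstar)) ^+ 2 <= enorm (grad J x) ^+ 2 /\
             enorm (grad J x) ^+ 2 <= MJ ^+ 2) ->
  (* conclusion: uniform global practical asymptotic stability of xt = 0 *)
  exists beta : R -> R -> R, class_KL beta /\
    forall nu : R, 0 < nu -> exists epsstar : R, 0 < epsstar /\
      forall eps : R, 0 < eps -> eps < epsstar ->
        forall (x0 : 'rV[R]_n) (tau0 : R), 0 <= tau0 ->
          forall (ts : \bar R) (xs : R -> 'rV[R]_n) (taus : R -> R),
            es_solution b0 J b omega xstar eps x0 tau0 ts xs taus ->
            (exists (xs' : R -> 'rV[R]_n) (taus' : R -> R),
               es_solution b0 J b omega xstar eps x0 tau0 +oo%E xs' taus' /\
               forall t, 0 <= t -> (t%:E < ts)%E -> xs' t = xs t /\ taus' t = taus t) /\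
            (forall t, 0 <= t -> (t%:E < ts)%E ->
               enorm (xs t) <= beta (enorm x0) t + nu).
Proof.
move=> _ _ _ omega_inj omega_gt0 _ gamma_gt0 excite J_min _ LJ_gt0 hessJ.
move=> kappa_gt0 b0J L0_gt0 b0_lip gamma_kappa [dJ [ddJ _]] J_coercive Kalpha MJ_gt0 gradJ2.
have kappa_ge0 := ltW kappa_gt0; have LJ_ge0 := ltW LJ_gt0; have L0_ge0 := ltW L0_gt0.
have MJ_ge0 := ltW MJ_gt0.
have gradJ x : enorm (grad J x) <= MJ.
  by have [_] := gradJ2 x; rewrite ler_pXn2r ?nnegrE ?enorm_ge0.
have cJ : continuous J by move=> x; exact: differentiable_continuous.
pose w := @es_frequency R r omega; pose amp := @es_amplitude R r omega.
have w_gt0 m : 0 < w m by rewrite ltr0q.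
pose gain m := amp m / w m.
have amp_ge0 m : 0 <= amp m by exact: sqrtr_ge0.
have gain_ge0 m : 0 <= gain m by rewrite divr_ge0 ?amp_ge0// ltW.
have gain_freq m : gain m * w m = amp m by rewrite divfK// gt_eqF.
have gain_amp m : gain m * amp m = 2.
  have w2_ge0 : 0 <= 2 * w m by rewrite mulr_ge0// ltW.
  by rewrite /gain mulrAC -expr2 (sqr_sqrtr w2_ge0) mulfK// gt_eqF.
have w_inj : forall m m', w m = w m' -> m.2 = m'.2 -> m = m'.
  by move=> [i j] [i' j'] /fmorph_inj/omega_inj /= -> ->.
have excitation v : gamma * enorm v ^+ 2 <= \sum_m edot (b m.1 m.2) v ^+ 2.
  by rewrite (le_trans (excite v))// (pair_big xpredT xpredT
    (fun i j => edot (b i j) v ^+ 2)).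
have [C0 [C1 [C0_ge0 [C1_ge0 descent]]]] := descent_along_transform w_gt0 w_inj amp_ge0
  gain_ge0 gain_freq gain_amp gamma_kappa kappa_ge0 LJ_ge0 MJ_ge0 excitation dJ ddJ hessJ
  gradJ b0J.
have [mu [Kmu mu_unbounded mu_le]] := coercive_lower_bound cJ J_min J_coercive.
(* A rate in terms of the excess cost [y]: the bound [y <= MJ * rad] gives [rad >= MJ^-1 * y], and
   [alphaJ] turns this into a gradient bound. Half of [gamma - kappa3] is kept back to absorb the
   perturbation [C1 * eps]. *)
pose rho := (fun s : R => (gamma - kappa3) / 2 * s) \o (fun s => s ^+ 2) \o alphaJ \o
  (fun s => MJ^-1 * s).
have Krho : class_K rho.
  apply: class_K_comp; last by apply: class_K_scale; rewrite invr_gt0.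
  apply: class_K_comp Kalpha; apply: class_K_comp class_K_sqr.
  by apply: class_K_scale; rewrite divr_gt0// subr_gt0.
have MJ2_gt0 : 0 < 2 * MJ by rewrite mulr_gt0.
have [beta KLbeta beta_ge] := class_KL_of_gain MJ2_gt0 Kmu mu_unbounded (class_K_comp Krho Kmu).
exists beta; split=> // nu nu_gt0.
have nu2_gt0 : 0 < nu / 2 by rewrite divr_gt0.
(* Excess cost at most [eta] forces [rad <= nu / 2]; the other half of [nu] pays for the distance
   between [x] and its transform. *)
pose eta := mu (nu / 2).
have eta_gt0 : 0 < eta by exact: class_K_gt0.
have rho_eta_gt0 : 0 < rho eta by exact: class_K_gt0.
have small C e : 0 <= C -> 0 < e -> exists2 eps0 : R, 0 < eps0 &
    forall eps, 0 < eps -> eps < eps0 -> C * eps <= e.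
  move=> C_ge0 e_gt0; have C_gt0 : 0 < C + 1 by rewrite ltr_wpDl.
  exists (e / (C + 1)) => [|eps eps_gt0]; first by rewrite divr_gt0.
  rewrite ltr_pdivlMr// => /ltW; apply: le_trans.
  by rewrite mulrC ler_pM2l// lerDl.
(* The thresholds make, in turn, the perturbation at most [rho eta], the transform error at most
   [nu / 2], and the excess cost from a start within [C0 * eps] at most [eta]. *)
have [e1 e1_gt0 e1P] := small C1 _ C1_ge0 rho_eta_gt0.
have [e2 e2_gt0 e2P] := small C0 _ C0_ge0 nu2_gt0.
have [e3 e3_gt0 e3P] := small (2 * MJ * C0) _ (mulr_ge0 (ltW MJ2_gt0) C0_ge0) eta_gt0.
exists (Num.min (Num.min 1 e1) (Num.min e2 e3)); split.
  by rewrite !lt_min ltr01 e1_gt0 e2_gt0.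
move=> eps eps_gt0; rewrite !lt_min => /andP[/andP[/ltW eps_le1 /(e1P _ eps_gt0) eps1]].
move=> /andP[/(e2P _ eps_gt0) eps2 /(e3P _ eps_gt0) eps3].
move=> x0 tau0 tau0_ge0 ts xs taus sol.
have [x [x_0 dx]] := es_global_solution b omega xstar dJ MJ_ge0 gradJ kappa_ge0
  b0J L0_ge0 b0_lip x0 tau0 eps_gt0.
pose tau t := tau0 + eps ^- 2 * t.
have dtau (t : R) : is_derive t 1 tau (eps ^- 2).
  apply: is_derive_eq (is_derive_add (is_derive_const t tau0)
    (is_derive_mull (eps ^- 2) (is_derive_id t 1))) _.
  by rewrite add0r mulr1.
have agree := es_solution_unique dJ MJ_ge0 gradJ L0_ge0 b0_lip eps_gt0 sol x_0 dx.
split.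
  exists x, tau; split; last exact: agree.
  split=> //; split=> //; split; first by rewrite /tau mulr0 addr0.
  split; [|split].
  - apply: continuous_in_subspaceT => t; rewrite inE/= => -[t0 _].
    by apply: differentiable_continuous; apply/derivable1_diffP; case: (dx t t0).
  - apply: continuous_in_subspaceT => t _; exact: is_derive_continuous (dtau t).
  - by move=> t t0 _; split; [apply: dx; exact: ltW|exact: dtau].
suff bound : forall t, 0 <= t -> enorm (x t) <= beta (enorm x0) t + nu.
  by move=> t t0 tts; rewrite -(agree t t0 tts).1 bound.
pose X t := x t + xstar.
have trajX : es_trajectory (fun m => b m.1 m.2) w amp (fun m => m.2) b0 J eps X tau.
  move=> s s0; split; last exact: dtau.
  rewrite -(es_fieldE b omega b0 J xstar eps (x s) (tau s)) -[es_field _ _ _ _ _ _ _ _]addr0.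
  apply/is_derive_rowP => i; rewrite (_ : (fun _ => _) = fun s => x s 0 i + xstar 0 i).
    rewrite mxE [X in _ + X]mxE; apply: is_derive_add.
    by move/is_derive_rowP: (dx s s0).
  by apply/funext => u; rewrite mxE.
have [z zP] := descent eps X tau eps_gt0 eps_le1 trajX.
pose y t := J (z t) - J xstar; pose rad t := enorm (z t - xstar).
have rad_ge0 t : 0 <= rad t by exact: enorm_ge0.
have y_le t : y t <= MJ * rad t by exact: lipschitz_of_grad_le.
have mu_le_y t : mu (rad t) <= y t by exact: mu_le.
have y_ge0 t : 0 <= y t by exact: le_trans (class_K_ge0 Kmu (rad_ge0 t)) (mu_le_y t).
have [dy dyE] : exists dy : R -> R, forall t : R, 0 <= t -> is_derive t 1 y (dy t) /\
    dy t <= - ((gamma - kappa3) * enorm (grad J (z t)) ^+ 2) + C1 * eps.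
  have /choice[dy dyE] (t : R) : exists y', 0 <= t -> is_derive t 1 (fun s => J (z s)) y' /\
      y' <= - ((gamma - kappa3) * enorm (grad J (z t)) ^+ 2) + C1 * eps.
    have [t0|] := leP 0 t; last by exists 0.
    by have [_ [y' [dy' y'_le]]] := zP t t0; exists y'.
  exists dy => t t0; have [dyt dy_le] := dyE t t0; split=> //.
  rewrite -[dy t]subr0; exact: (is_derive_sub dyt (is_derive_const t (J xstar))).
have dy_le s : 0 <= s -> eta <= y s -> dy s <= - rho (y s).
  move=> s0 eta_y; rewrite (le_trans (dyE s s0).2)//.
  have rho_le : C1 * eps <= rho (y s).
    by rewrite (le_trans eps1)// class_K_le// ltW.
  have grad_ge : alphaJ (MJ^-1 * y s) ^+ 2 <= enorm (grad J (z s)) ^+ 2.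
    have y_MJ : 0 <= MJ^-1 * y s by rewrite mulr_ge0 ?invr_ge0.
    have y_rad : MJ^-1 * y s <= rad s by rewrite mulrC ler_pdivrMr// mulrC y_le.
    apply: le_trans (gradJ2 _).1; apply: lerXn2r; rewrite ?nnegrE.
    - exact: class_K_ge0.
    - exact: class_K_ge0 (rad_ge0 s).
    - exact: class_K_le y_rad.
  have gk : 0 <= gamma - kappa3 by rewrite subr_ge0 ltW.
  have := ler_wpM2l gk grad_ge; move: rho_le; rewrite /rho/=.
  by set q := alphaJ _ ^+ 2; set p := enorm _ ^+ 2; lra.
have decay := decay_above_level (fun t t0 => (dyE t t0).1)
  (fun u v uv => class_K_le Krho (le_trans (ltW eta_gt0) uv)) rho_eta_gt0 dy_le.
move=> t t0.
have near_x s : 0 <= s -> enorm (z s - X s) <= C0 * eps by move=> /zP[].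
have x_le : enorm (x t) <= rad t + C0 * eps.
  have -> : x t = (z t - xstar) - (z t - X t) by rewrite /X opprB addrC addrA subrK addrK.
  by rewrite (le_trans (enormD_le _ _))// enormN lerD2l near_x.
have rad0_le : rad 0 <= enorm x0 + C0 * eps.
  rewrite /rad (_ : z 0 - xstar = x0 + (z 0 - X 0)); last first.
    by rewrite /X x_0 opprD addrCA addNKr.
  by rewrite (le_trans (enormD_le _ _))// lerD2l near_x.
have beta_ge0 : 0 <= beta (enorm x0) t.
  exact: (class_K_ge0 (KLbeta.1 t t0) (enorm_ge0 x0)).
have r_small : mu (rad t) <= eta -> rad t <= nu / 2.
  move=> mu_rad; rewrite leNgt; apply/negP => /(class_K_lt Kmu (ltW nu2_gt0)).
  by rewrite ltNge mu_rad.
suff : rad t <= beta (enorm x0) t \/ rad t <= nu / 2 by case; lra.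
have [eta_y|/ltW y_eta] := leP eta (y t); last first.
  by right; apply: r_small; exact: le_trans y_eta.
have yt := decay t t0 eta_y.
have gain_le : mu (rad t) + t * rho (mu (rad t)) <= MJ * (enorm x0 + C0 * eps).
  apply: (@le_trans _ _ (y t + t * rho (y t))).
    by rewrite lerD// ler_wpM2l// class_K_le// class_K_ge0.
  by rewrite (le_trans yt)// (le_trans (y_le 0))// ler_wpM2l.
(* A start within the transform error has initial excess cost at most [eta]. Otherwise the error is
   below [enorm x0], so the gain inequality holds with constant [2 * MJ], as [beta] requires. *)
have [x0_small|x0_large] := leP (enorm x0) (C0 * eps).
  right; apply: r_small.
  have : 0 <= t * rho (mu (rad t)) by rewrite mulr_ge0// class_K_ge0// class_K_ge0.
  have : MJ * (enorm x0 + C0 * eps) <= MJ * (C0 * eps + C0 * eps).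
    by rewrite ler_wpM2l// lerD2r.
  by lra.
left; apply: beta_ge => //; first exact: enorm_ge0.
rewrite (le_trans gain_le)// (mulrC 2) -mulrA ler_wpM2l//.
by move/ltW: x0_large; lra.
Qed.
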